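(* Let $\Gamma$ be any finitely generated group of (orientation preserving) $C^2$ diffeomorphisms of the circle $\mathrm{S}^1$ whose action on $\mathrm{S}^1$ is non minimal and such that for every $x \in \mathrm{S}^1$ the stabilizer $\{g \in \Gamma : g(x) = x\}$ is either trivial or infinite cyclic. Then there exists a bi-Lipschitz (orientation preserving) homeomorphism $h : \mathrm{S}^1 \to \mathrm{S}^1$ which is not $C^1$ and which commutes with every element of $\Gamma$. Moreover, such a homeomorphism $h$ can be taken to be non differentiable on every open interval of the circle (that is, for every non-empty open interval $J \subset \mathrm{S}^1$, the restriction of $h$ to $J$ is not a differentiable map).
   Context: A homeomorphism $h$ of $\mathrm{S}^1$ is bi-Lipschitz if both $h$ and $h^{-1}$ are Lipschitz. The action of $\Gamma$ on $\mathrm{S}^1$ is minimal if every orbit is dense, and non minimal otherwise. *)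

(* Defs.v *)
From HB Require Import structures.
From mathcomp Require Import all_boot all_order all_algebra.
From mathcomp Require Import generic_quotient ring zify.
From mathcomp Require Import all_classical all_reals all_analysis.

Set Implicit Arguments.
Unset Strict Implicit.
Unset Printing Implicit Defensive.

Import Order.TTheory GRing.Theory Num.Theory.
Import numFieldNormedType.Exports.

Local Open Scope classical_set_scope.
Local Open Scope ring_scope.
Local Open Scope quotient_scope.

Section Circle.
Variable R : realType.

Definition eq_mod1 : rel R := [rel x y | x - y \is a Num.int].

Lemma eq_mod1_refl : reflexive eq_mod1.
Proof. by move=> x; rewrite /eq_mod1 /= subrr rpred0. Qed.

Lemma eq_mod1_sym : symmetric eq_mod1.
Proof. by move=> x y; rewrite /eq_mod1 /= -opprB rpredN. Qed.

Lemma eq_mod1_trans : transitive eq_mod1.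
Proof.
by move=> y x z xy yz; rewrite /eq_mod1 /= -(subrKA y) rpredD.
Qed.

Canonical eq_mod1_equiv := EquivRel eq_mod1 eq_mod1_refl eq_mod1_sym eq_mod1_trans.

(* The circle is R / Z; its metric is the quotient of the metric of R, i.e.
   arc length for total length 1. *)
Definition circle : Type := {eq_quot eq_mod1}.

HB.instance Definition _ := Choice.copy circle {eq_quot eq_mod1}.

Definition proj (x : R) : circle := \pi_{eq_quot eq_mod1} x.

Definition cdist (p q : circle) : R :=
  inf [set r | exists x y, [/\ proj x = p, proj y = q & r = `|x - y|]].

Lemma projP x y : proj x = proj y <-> x - y \is a Num.int.
Proof.
split=> [/eqP|xy]; first by rewrite /proj eqmodE.
by apply/eqP; rewrite /proj eqmodE.
Qed.

Lemma proj_surj p : exists x, proj x = p.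
Proof. by exists (repr (p : {eq_quot eq_mod1})); exact: reprK. Qed.

Lemma cdist_le x y : cdist (proj x) (proj y) <= `|x - y|.
Proof.
apply: ge_inf; last by exists x, y.
by exists 0 => _ [a [b [_ _ ->]]].
Qed.

Lemma cdist_adherent p q (e : R) : 0 < e ->
  exists x y, [/\ proj x = p, proj y = q & `|x - y| < cdist p q + e].
Proof.
move=> e0; have [x xp] := proj_surj p; have [y yq] := proj_surj q.
have : has_inf [set r : R | exists x y,
    [/\ proj x = p, proj y = q & r = `|x - y|]].
  split; first by exists `|x - y|, x, y.
  by exists 0 => _ [a [b [_ _ ->]]].
by move=> /(inf_adherent e0)[_ [a [b [ap bq ->]]] lt_e]; exists a, b.
Qed.

Lemma cdist_ge0 p q : 0 <= cdist p q.
Proof.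
apply: lb_le_inf => [|_ [a [b [_ _ ->]]]//].
have [x xp] := proj_surj p; have [y yq] := proj_surj q.
by exists `|x - y|, x, y.
Qed.

Lemma cdistxx p : cdist p p = 0.
Proof.
apply/eqP; rewrite eq_le cdist_ge0 andbT.
have [x <-] := proj_surj p.
by have := cdist_le x x; rewrite subrr normr0.
Qed.

Lemma cdist_sym p q : cdist p q = cdist q p.
Proof.
suff le_sym a b : cdist a b <= cdist b a by apply/eqP; rewrite eq_le !le_sym.
apply/ler_addgt0Pl => e e0; rewrite addrC.
have [x [y [xb ya lt_e]]] := cdist_adherent b a e0.
by apply: le_trans (ltW lt_e); rewrite -xb -ya distrC cdist_le.
Qed.

Lemma cdist_triangle q p r : cdist p r <= cdist p q + cdist q r.
Proof.
apply/ler_addgt0Pl => e e0; have e20 : 0 < e / 2 by rewrite divr_gt0.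
have [x [y [xp yq lt1]]] := cdist_adherent p q e20.
have [y' [z [y'q zr lt2]]] := cdist_adherent q r e20.
have zr' : proj (z + (y - y')) = r.
  by rewrite -zr; apply/projP; rewrite addrC addKr; apply/projP; rewrite yq.
rewrite -xp -zr'; apply: le_trans (cdist_le _ _) _.
rewrite (_ : x - _ = (x - y) + (y' - z)); last by ring.
apply: le_trans (ler_normD _ _) _; rewrite xp zr'.
apply: le_trans (lerD (ltW lt1) (ltW lt2)) _.
by rewrite addrACA -splitr addrC.
Qed.

Lemma cdist_positivity p q : cdist p q = 0 -> p = q.
Proof.
move=> d0.
have half0 : 0 < 2^-1 :> R by rewrite invr_gt0.
have [x [y [xp yq]]] := cdist_adherent p q half0; rewrite d0 add0r => xy.
have [/eqP|nxy] := eqVneq (x - y) 0.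
  by rewrite subr_eq0 => /eqP exy; rewrite -xp -yq exy.
have n0 : 0 < Num.min 2^-1 `|x - y| by rewrite lt_min half0 normr_gt0.
have [x' [y' [x'p y'q]]] := cdist_adherent p q n0.
rewrite d0 add0r lt_min => /andP[x'y' lt_xy].
have /intrP[i ei] : (x - y) - (x' - y') \is a Num.int.
  rewrite (_ : _ - _ = (x - x') - (y - y')); last by ring.
  by rewrite rpredB //; apply/projP; rewrite ?xp ?yq.
have lt1 : `|i%:~R : R| < 1.
  rewrite -ei; apply: le_lt_trans (ler_normB _ _) _.
  by rewrite [1]splitr !div1r ltrD.
have i0 : i = 0.
  by move: lt1; rewrite -intr_norm -[1]/(1%:~R) ltr_int; lia.
by move: ei lt_xy; rewrite i0 => /eqP; rewrite subr_eq0 => /eqP ->; rewrite ltxx.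
Qed.

HB.instance Definition _ := @isMetric.Build R circle cdist
  cdistxx cdist_positivity cdist_sym cdist_triangle.


Implicit Types (F : R -> R) (f h k : circle -> circle).

Definition is_lift F f : Prop :=
  continuous F /\ forall t, f (proj t) = proj (F t).

Definition Ck_fun (n : nat) F : Prop :=
  (forall m, (m < n)%N -> forall t, derivable (derive1n m F) t 1) /\
  continuous (derive1n n F).

(* Every continuous circle map has continuous lifts, any two of which differ by
   an integer constant; since proj is a local diffeomorphism, a circle map is
   C^n iff it has a C^n lift. *)
Definition Ck_map (n : nat) f : Prop := exists F, is_lift F f /\ Ck_fun n F.

Definition orientation_preserving f : Prop :=
  exists F, is_lift F f /\ {homo F : s t / s < t}.

Definition homeomorphism f : Prop :=
  exists k, [/\ cancel f k, cancel k f, continuous f & continuous k].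

Definition Ck_diffeo (n : nat) f : Prop :=
  exists k, [/\ cancel f k, cancel k f, Ck_map n f & Ck_map n k].

Definition Lipschitz f : Prop :=
  exists L : R, forall p q, mdist (f p) (f q) <= L * mdist p q.

Definition bi_Lipschitz f : Prop :=
  exists k, [/\ cancel f k, cancel k f, Lipschitz f & Lipschitz k].

(* F is f read in the charts given by local inverses of proj: it is only
   constrained near t, and its differentiability at t forces continuity there,
   hence that it stays in a single chart. *)
Definition differentiable_at f (p : circle) : Prop :=
  exists t F, [/\ proj t = p, \forall s \near t, f (proj s) = proj (F s)
                & derivable F t 1].

Definition open_interval (J : set circle) : Prop :=
  exists a b : R, [/\ a < b, b <= a + 1 & J = proj @` `]a, b[%classic].

End Circle.

Section Transformation_groups.
Variable T : Type.
Implicit Types (G S : set (T -> T)).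

Definition transformation_group G : Prop :=
  [/\ G id,
      forall f g, G f -> G g -> G (f \o g)
    & forall f, G f -> exists g, [/\ G g, cancel f g & cancel g f]].

(* Meaningful for sets S of bijections; if S contains a non-bijection, no
   transformation group contains it and generated_group S is setT. *)
Definition generated_group S : set (T -> T) := smallest transformation_group S.

Definition finitely_generated G : Prop :=
  exists S, finite_set S /\ G = generated_group S.

Definition infinite_cyclic G : Prop :=
  infinite_set G /\ exists a, G = generated_group [set a].

Definition orbit G (x : T) : set T := [set g x | g in G].

Definition stabilizer G (x : T) : set (T -> T) := [set g | G g /\ g x = x].

End Transformation_groups.

Definition minimal_action (T : topologicalType) (G : set (T -> T)) : Prop :=
  forall x, dense (orbit G x).

(* Main.v *)
(* A group of circle diffeomorphisms is replaced by the group L of all its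
   increasing lifts, which contains the integer translations. Call an
   interval wandering if every element of L either moves it off itself or
   fixes it pointwise. Wandering intervals are dense: a non-dense orbit
   yields closed invariant sets whose complements fill a dense set, an
   element of L mapping a point of a complementary interval back into it
   fixes the left endpoint of that interval, and the stabilizer of this
   endpoint is trivial or cyclic.

   Each wandering interval J gets a bi-Lipschitz homeomorphism with a dense
   set of corners, transported to F(J) by conjugation with F; the identity
   is kept elsewhere. The result commutes with L, and it is bi-Lipschitz by
   the classical distortion estimate of C^2 dynamics: along a shortest word
   from J to F(J) the intermediate intervals are disjoint modulo 1, so their
   lengths sum to at most 2 and the slopes of F on J vary by a factor at
   most exp(2M), where M bounds the logarithmic derivatives of the slopes of
   the generators. *)
Require Import Defs.
From mathcomp Require Import all_boot all_order all_algebra.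
From mathcomp Require Import ring lra zify.
From mathcomp Require Import all_classical all_reals all_analysis.

Set Implicit Arguments.
Unset Strict Implicit.
Unset Printing Implicit Defensive.

Import Order.TTheory GRing.Theory Num.Theory.
Import numFieldNormedType.Exports.

Local Open Scope classical_set_scope.
Local Open Scope ring_scope.

(* Some library files also define [proj], for product topologies. *)
Local Notation proj := Defs.proj.

(** * A bi-Lipschitz function with a dense set of corners *)

(** The difference quotients at [t] and [- t] have the same limit, so the second difference is
    [o(t)]. A convex corner violates this. *)
Lemma derivable_second_difference (R : realType) (f : R -> R) (x e : R) :
  derivable f x 1 -> 0 < e ->
  exists2 t, 0 < t & f (x + t) + f (x - t) - 2 * f x < e * t.
Proof.
move=> /cvg_ex[/= d dfx] e0; have e20 : 0 < e / 2 by rewrite divr_gt0.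
move/cvgrPdist_lt : dfx => /(_ _ e20) /nbhs_ballP[/= r r0 near_d].
pose t := r / 2; have t0 : 0 < t by rewrite divr_gt0.
have tr : t < r by rewrite /t; lra.
exists t => //.
have := near_d t; rewrite /ball/= sub0r normrN gtr0_norm//.
move=> /(_ tr (lt0r_neq0 t0)).
have := near_d (- t); rewrite /ball/= sub0r opprK gtr0_norm// oppr_eq0.
move=> /(_ tr (lt0r_neq0 t0)).
rewrite !/GRing.scale/= !mulr1 ![_ + x]addrC !ltr_norml.
move=> /andP[_ hA] /andP[hB _].
set A := f (x - t) - f x in hA; set B := f (x + t) - f x in hB.
have -> : f (x + t) + f (x - t) - 2 * f x = A + B by rewrite /A/B; ring.
have hA' : d * t + A < e / 2 * t.
  have -> : d * t + A = (d - (- t)^-1 * A) * t.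
    by field; exact: lt0r_neq0.
  by rewrite ltr_pM2r.
have hB' : B - d * t < e / 2 * t.
  have -> : B - d * t = (t^-1 * B - d) * t.
    by field; exact: lt0r_neq0.
  rewrite ltr_pM2r//; lra.
lra.
Qed.

Section Corners.
Variables (R : realType) (q : nat -> R).

(* Subtracting [`|q k|] makes the series converge for unbounded [q]. *)
Let term (x : R) (k : nat) : R := 2^-1 ^+ k.+1 * (`|x - q k| - `|q k|).

(** Each term has a convex kink at [q k], and the weights sum to [1], so the series is 1-Lipschitz;
    adding half of it to the identity leaves slopes between [1/2] and [3/2]. *)
Definition corners (x : R) : R := x + 2^-1 * limn (series (term x)).

Let termB x y k : term x k - term y k <= 2^-1 ^+ k.+1 * `|x - y|.
Proof.
rewrite /term -mulrBr ler_wpM2l ?exprn_ge0 ?invr_ge0//.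
have := ler_normD (x - y) (y - q k).
by rewrite subrKA; lra.
Qed.

Let cvg_term x : cvgn (series (term x)).
Proof.
apply: normed_cvg.
apply: (@series_le_cvg _ _ (geometric (2^-1 * `|x|) 2^-1)) => [k|k|k|].
- exact: normr_ge0.
- by rewrite geometric_ge0 ?mulr_ge0 ?invr_ge0.
- rewrite /geometric/= /term normrM ger0_norm ?exprn_ge0 ?invr_ge0// exprS.
  rewrite [leRHS]mulrAC ler_wpM2l ?mulr_ge0 ?exprn_ge0 ?invr_ge0//.
  have := ler_dist_dist (x - q k) (- q k).
  by rewrite normrN opprK subrK.
- by apply: is_cvg_geometric_series; rewrite ger0_norm ?invr_ge0//; lra.
Qed.

Let lip x y : limn (series (term x)) - limn (series (term y)) <= `|x - y|.
Proof.
rewrite -limB//; apply: limr_le; first exact: is_cvgB.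
apply: nearW => n; rewrite !fctE /series/=. rewrite -sumrB.
apply: (le_trans (ler_sum _ (fun k _ => termB x y k))).
rewrite -mulr_suml -[leRHS]mul1r ler_wpM2r//.
have := @geometric_le_lim R n 2^-1 2^-1.
rewrite (_ : _ * (1 - 2^-1)^-1 = 1); last by field.
move=> h; apply: le_trans (h _ _ _) => //; last first.
  by rewrite ger0_norm ?invr_ge0//; lra.
by rewrite le_eqVlt; apply/orP; left; apply/eqP/eq_bigr => i _; rewrite exprS.
Qed.

Lemma corners_slope x y : x <= y ->
  2^-1 * (y - x) <= corners y - corners x <= 3 / 2 * (y - x).
Proof.
move=> xy; rewrite /corners.
have := lip x y; have := lip y x; rewrite distrC ler0_norm ?subr_le0//.
by move=> h1 h2; apply/andP; split; lra.
Qed.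

(** Every term is convex and has a non-negative second difference; the term of index [k] alone
    contributes twice its weight times [t], and the factor [1/2] in [corners] halves this. *)
Lemma corners_second_difference k t : 0 < t ->
  2^-1 ^+ k.+1 * t <= corners (q k + t) + corners (q k - t) - 2 * corners (q k).
Proof.
move=> t0; rewrite /corners.
set l1 := limn _; set l2 := limn _; set l3 := limn _.
suff : 2 * 2^-1 ^+ k.+1 * t <= l1 + l2 - 2 * l3 by lra.
have cvg_l : (series (term (q k + t)) \+ series (term (q k - t))
    - (fun n => 2 * series (term (q k)) n)) @ \oo --> l1 + l2 - 2 * l3.
  by apply: cvgB; [apply: cvgD | apply: cvgMl_tmp]; exact: cvg_term.
apply: (cvgr_to_ge cvg_l).
exists k.+1 => // n kn; rewrite !fctE /series/=.
rewrite mulr_sumr -big_split/= -sumrB big_mkord (bigD1 (Ordinal kn))//=.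
rewrite -[leLHS]addr0 lerD//.
  rewrite /term (addrAC (q k)) subrr add0r (addrAC (q k) (- t)) subrr add0r.
  by rewrite normrN gtr0_norm// normr0; lra.
apply: sumr_ge0 => i _; rewrite /term.
set c := _ ^+ _; have c0 : 0 <= c by rewrite exprn_ge0 ?invr_ge0.
have : 2 * `|q k - q i| <= `|q k + t - q i| + `|q k - t - q i|.
  have := ler_normD (q k + t - q i) (q k - t - q i).
  rewrite (_ : _ + _ = 2 * (q k - q i)); last by ring.
  by rewrite normrM normr_nat.
move=> h; have := mulr_ge0 c0 (eq_ind _ is_true h _ (esym (subr_ge0 _ _))).
nra.
Qed.

Lemma corners_not_derivable (k : nat) (a c : R) :
  0 < c -> ~ derivable (fun x => a + c * corners x) (q k) 1.
Proof.
move=> c0 /derivable_second_difference.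
move=> /(_ (c * 2^-1 ^+ k.+1)); rewrite mulr_gt0 ?exprn_gt0 ?invr_gt0//.
case=> // t t0 /=; have := corners_second_difference k t0.
move=> /(ler_wpM2l (ltW c0)); lra.
Qed.

End Corners.

(** The corners are placed at the rationals, enumerated by [unpickle]. The maps [d + c * G] are the
    affine rescalings through which [G] enters [bend]. *)
Lemma exists_dense_corners (R : realType) : exists G : R -> R,
  (forall x y, x <= y -> 2^-1 * (y - x) <= G y - G x <= 3 / 2 * (y - x)) /\
  forall a b, a < b -> exists x, a < x < b /\
    forall d c, 0 < c -> ~ derivable (fun t => d + c * G t) x 1.
Proof.
pose q (k : nat) : R := ratr (odflt 0 (unpickle k)).
exists (corners q); split=> [|a b /rat_in_itvoo[r]]; first exact: corners_slope.
rewrite in_itv/= => rab; exists (ratr r); split => // d c c0.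
have -> : ratr r = q (pickle r) by rewrite /q pickleK.
exact: corners_not_derivable.
Qed.

(** * Distortion on wandering intervals *)

(** Translate each interval so that its left end lies in [[0, 1[]. An interval longer than [1] would
    meet its own translate by [1], so the translates lie in [[0, 2]]; they are disjoint, and
    Lebesgue measure bounds their total length. *)
Lemma sum_disjoint_mod1 (R : realType) (n : nat) (u v : nat -> R) :
  (forall i, (i < n)%N -> u i < v i) ->
  (forall i j (m : int) (x : R), (i < n)%N -> (j < n)%N -> u i < x < v i ->
     u j < x + m%:~R < v j -> i = j /\ m = 0) ->
  \sum_(i < n) (v i - u i) <= 2.
Proof.
move=> uv disj.
pose a i := u i - (Num.floor (u i))%:~R.
pose b i := v i - (Num.floor (u i))%:~R.
have a_itv i : 0 <= a i < 1.
  by have := floor_itv (u i); rewrite /a intrD;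
    move=> /andP[? ?]; apply/andP; split; lra.
have b_le i : (i < n)%N -> b i <= 2.
  move=> ilt; have [//|b2] := leP (b i) 2; exfalso.
  have := a_itv i; rewrite /a /b in b2 * => /andP[_ ai].
  pose x := (u i + v i - 1) / 2.
  have [||_ //] := disj i i 1 x ilt ilt; rewrite /x; apply/andP; split; lra.
have ab i : (i < n)%N -> a i < b i by move=> /uv; rewrite ltrD2r.
pose I i : set R := `]a i, b i[%classic.
have : (lebesgue_measure (\big[setU/set0]_(i < n) I i)
        <= lebesgue_measure [set` `[0%R, 2%R :> R]])%E.
  apply: le_measure; rewrite ?inE.
  - by apply: bigsetU_measurable => i _; exact: measurable_itv.
  - exact: measurable_itv.
  rewrite -(bigcup_mkord n I) => x [i /= ilt].
  rewrite /I/= !in_itv/= => /andP[ax xb].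
  have /andP[a0 _] := a_itv i; have := b_le _ ilt.
  by rewrite (le_trans a0 (ltW ax)) => /(le_trans (ltW xb)).
rewrite measure_semi_additive_ord_I//; first last.
- by apply: bigsetU_measurable => i _; exact: measurable_itv.
- move=> i j /= ilt jlt [x []]; rewrite /I /= !in_itv/= /a /b => xi xj.
  have [] // := disj i j (Num.floor (u j) - Num.floor (u i))
    (x + (Num.floor (u i))%:~R) ilt jlt.
    by move: xi => /andP[? ?]; apply/andP; split; lra.
  by move: xj; rewrite intrB => /andP[? ?]; apply/andP; split; lra.
- by move=> i _; exact: measurable_itv.
rewrite (eq_bigr (fun i : 'I_n => (v i - u i)%:E)) => [|i _].
  by rewrite sumEFin lebesgue_measure_itv/= !lte_fin ltr0n/= sube0 lee_fin.
have := lebesgue_measure_itv `]a i, b i[.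
rewrite /= lte_fin ab// => ->; rewrite -EFinD; congr (_%:E).
by rewrite /a /b; ring.
Qed.

(** Cross-multiplied form of: any two difference quotients of [F] on [[a, b]] have ratio at most
    [c]. *)
Definition slope_ratio_le (R : realType) (c a b : R) (F : R -> R) : Prop :=
  forall x y u v, a <= x <= b -> a <= y <= b -> a <= u <= b -> a <= v <= b ->
  `|F x - F y| * `|u - v| <= c * (`|F u - F v| * `|x - y|).

Lemma slope_ratio_leW (R : realType) (c d a b : R) (F : R -> R) :
  c <= d -> slope_ratio_le c a b F -> slope_ratio_le d a b F.
Proof.
move=> cd slF x y u v xab yab uab vab.
apply: le_trans (slF _ _ _ _ xab yab uab vab) _.
by rewrite ler_wpM2r// mulr_ge0.
Qed.

(** A difference quotient of [G \o F] is one of [G] times one of [F], so the constants multiply. *)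
Lemma slope_ratio_le_comp (R : realType) (c d a b : R) (F G : R -> R) :
  0 <= d -> {homo F : s t / s < t} ->
  slope_ratio_le c a b F -> slope_ratio_le d (F a) (F b) G ->
  slope_ratio_le (c * d) a b (G \o F).
Proof.
move=> d0 Flt hF hG x y u v xab yab uab vab /=.
have Fab z : a <= z <= b -> F a <= F z <= F b.
  by move=> /andP[az zb]; rewrite !(ltW_homo Flt).
have [<-|uv] := eqVneq u v; first by rewrite !subrr normr0 mulr0 mul0r mulr0.
have := hG _ _ _ _ (Fab _ xab) (Fab _ yab) (Fab _ uab) (Fab _ vab).
have := hF _ _ _ _ xab yab uab vab.
have Fuv : 0 < `|F u - F v|.
  rewrite normr_gt0 subr_eq0.
  by case: (ltgtP u v) uv => // /Flt; [move/lt_eqF|move/gt_eqF] => ->.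
have uv0 : 0 < `|u - v| by rewrite normr_gt0 subr_eq0.
have := normr_ge0 (G (F x) - G (F y)); have := normr_ge0 (G (F u) - G (F v)).
move: Fuv uv0 (normr_ge0 (x - y)) (normr_ge0 (F x - F y)).
set A := `|G (F x) - _|; set B := `|G (F u) - _|; set D := `|F x - _|.
set E := `|F u - _|; set X := `|x - y|; set U := `|u - v|.
move=> E0 U0 X0 D0 B0 A0 h1 h2.
rewrite -(ler_pM2r E0) [leLHS]mulrAC.
apply: le_trans (ler_wpM2r (ltW U0) h2) _.
rewrite (_ : _ * U = d * B * (D * U)); last by ring.
rewrite (_ : c * d * _ * E = d * B * (c * (E * X))); last by ring.
by rewrite ler_wpM2l// mulr_ge0.
Qed.

Section Group_of_lifts.
Variables (R : realType) (L : set (R -> R)).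
Hypothesis L_group : transformation_group L.
Hypothesis L_lt : forall F, L F -> {homo F : s t / s < t}.
Hypothesis L_shift : forall m : int, L (fun t => t + m%:~R).

Implicit Types (F G H : R -> R) (a b : R).

Let L_comp F G : L F -> L G -> L (F \o G).
Proof. by case: L_group => _ + _; exact. Qed.

Let L_inv F : L F -> exists G, [/\ L G, cancel F G & cancel G F].
Proof. by case: L_group => _ _; exact. Qed.

Let L_id : L id. Proof. by case: L_group. Qed.

Let L_le F : L F -> {homo F : s t / s <= t}.
Proof. by move=> LF; apply: ltW_homo; exact: L_lt. Qed.

Let L_ltE F : L F -> {mono F : s t / s < t}.
Proof. by move=> LF; apply: leW_mono; apply: le_mono; exact: L_lt. Qed.

Let L_leE F : L F -> {mono F : s t / s <= t}.
Proof. by move=> LF; apply: le_mono; exact: L_lt. Qed.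

Let L_inj F : L F -> injective F.
Proof. by move=> LF; exact: (inc_inj (L_leE LF)). Qed.

Let L_addint F (m : int) : L F -> L (fun t => F t + m%:~R).
Proof. by move=> /(L_comp (L_shift m)). Qed.

Definition wandering a b : Prop := a < b /\
  forall F y, L F -> a < y < b -> a < F y < b ->
    forall z, a <= z <= b -> F z = z.

Lemma wandering_eq a b F G y z : wandering a b -> L F -> L G ->
  a < y < b -> a < z < b -> F y = G z -> forall t, a <= t <= b -> F t = G t.
Proof.
move=> [_ W] LF LG yab zab e t tab.
have [G' [LG' GK G'K]] := L_inv LG.
have := W (G' \o F) y (L_comp LG' LF) yab.
by rewrite /= e GK => /(_ zab t tab) /(congr1 G); rewrite G'K.
Qed.

Section Distortion.
Variables (S : set (R -> R)) (M : R).
Hypothesis S_sub : S `<=` L.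
Hypothesis S_addint : forall s (m : int), S s -> S (fun t => s t + m%:~R).
Hypothesis M_ge0 : 0 <= M.
Hypothesis S_slope : forall s a b, S s -> a <= b ->
  slope_ratio_le (1 + M * (b - a)) a b s.
Hypothesis S_gen : forall P : set (R -> R),
  (forall m : int, P (fun t => t + m%:~R)) ->
  (forall s F, S s -> P F -> P (s \o F)) -> L `<=` P.

(* Words are compared only through their action on [a, b], and integer
   translations have length 0, so that by [word_sphere_disjoint] a shortest word
   moves [a, b] through intervals that are disjoint modulo 1. *)
Fixpoint word_ball a b (n : nat) F : Prop := L F /\
  match n with
  | 0 => exists m : int, forall t, a <= t <= b -> F t = t + m%:~R
  | n'.+1 => exists s G, [/\ S s, word_ball a b n' G
                           & forall t, a <= t <= b -> F t = s (G t)]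
  end.

Definition word_sphere a b n F : Prop :=
  word_ball a b n F /\ forall k, (k < n)%N -> ~ word_ball a b k F.

Let word_ball_L a b n F : word_ball a b n F -> L F.
Proof. by case: n => [|n] []. Qed.

Let word_ball_addint a b n F (m : int) :
  word_ball a b n F -> word_ball a b n (fun t => F t + m%:~R).
Proof.
case: n => [[LF [k Fk]]|n [LF [s [G [Ss BG FE]]]]]; split; try exact: L_addint.
  by exists (k + m) => t /Fk ->; rewrite intrD addrA.
exists (fun t => s t + m%:~R), G; split => //; first exact: S_addint.
by move=> t /FE ->.
Qed.

Let word_ball_agree a b n F G : word_ball a b n F -> L G ->
  (forall t, a <= t <= b -> G t = F t) -> word_ball a b n G.
Proof.
case: n => [[LF [k Fk]]|n [LF [s [H [Ss BH FE]]]]] LG GF; split => //.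
  by exists k => t tab; rewrite GF// Fk.
by exists s, H; split => // t tab; rewrite GF// FE.
Qed.

Let word_ball_total a b F : L F -> exists n, word_ball a b n F.
Proof.
move=> LF; suff : L `<=` [set F | L F /\ exists n, word_ball a b n F].
  by move=> /(_ _ LF)[].
apply: S_gen => [m|s G Ss [LG [n BG]]]; split => //.
- by exists 0%N; split => //; exists m.
- by apply: L_comp => //; exact: S_sub.
- exists n.+1; split; first by apply: L_comp => //; exact: S_sub.
  by exists s, G.
Qed.

Let word_sphere_total a b F : L F -> exists n, word_sphere a b n F.
Proof.
move=> LF.
have [n Bn] := word_ball_total a b LF.
elim/ltn_ind: n Bn => n IH Bn.
have [[k [kn Bk]]|noball] := pselect (exists k, (k < n)%N /\ word_ball a b k F).
  exact: IH Bk.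
by exists n; split => // k kn Bk; apply: noball; exists k.
Qed.

(** By [wandering_eq], [F] and [G + m] agree on all of [[a, b]]. Adding an integer keeps the word
    length, so both shortest words have the same length. *)
Let word_sphere_disjoint a b i j F G (m : int) y z : wandering a b ->
  word_sphere a b i F -> word_sphere a b j G ->
  a < y < b -> a < z < b -> F y = G z + m%:~R -> i = j.
Proof.
move=> W [BF SF] [BG SG] yab zab e.
have LF := word_ball_L BF; have LG := word_ball_L BG.
have FG := wandering_eq W LF (L_addint m LG) yab zab e.
case: (ltngtP i j) => // ij; exfalso.
  apply: (SG _ ij); apply: word_ball_agree (word_ball_addint (- m) BF) LG _.
  by move=> t tab; rewrite FG// intrN addrK.
apply: (SF _ ij); apply: word_ball_agree (word_ball_addint m BG) LF _.
exact: FG.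
Qed.

(** [f k] is the action of the first [k] letters of a shortest word; these letters form a shortest
    word again, and the next one distorts by a factor at most [1 + M * (f k b - f k a)]. *)
Let word_sphere_slope a b n F : a < b -> word_sphere a b n F ->
  exists f : nat -> R -> R, [/\ f n = F,
    forall k, (k <= n)%N -> word_sphere a b k (f k) &
    slope_ratio_le (\prod_(k < n) (1 + M * (f k b - f k a))) a b F].
Proof.
move=> ab; elim: n F => [|n IH] F SF.
  exists (fun=> F); split => // [k|]; first by rewrite leqn0 => /eqP ->.
  rewrite big_ord0 => x y u v xab yab uab vab.
  have [[LF [m FE]] _] := SF; rewrite !FE// mul1r.
  have shiftB s t : s + m%:~R - (t + m%:~R) = s - t :> R by ring.
  by rewrite !shiftB mulrC.
have [[LF [s [G [Ss BG FE]]]] minF] := SF.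
have SG : word_sphere a b n G.
  split => // k kn Bk; apply: (minF k.+1) => //.
  by split => //; exists s, G.
have LG := word_ball_L BG.
have [f [fn Sf slG]] := IH _ SG.
exists (fun k => if (k <= n)%N then f k else F); split.
- by rewrite ltnn.
- by move=> k; case: ifP => [kn _|/negbT]; [exact: Sf|rewrite -ltnNge => nk kn;
    rewrite (_ : k = n.+1)//; apply/eqP; rewrite eqn_leq kn].
- rewrite big_ord_recr/= leqnn fn.
  rewrite (eq_bigr (fun k : 'I_n => 1 + M * (f k b - f k a))) => [|k _];
    last first.
    by rewrite ltnW.
  have GabM : slope_ratio_le (1 + M * (G b - G a)) (G a) (G b) s.
    by apply: S_slope => //; apply: L_le => //; exact: ltW.
  have := slope_ratio_le_comp _ (L_lt LG) slG GabM.
  move=> h x y u v xab yab uab vab; rewrite !FE//; apply: h => //.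
  rewrite addr_ge0// mulr_ge0// subr_ge0.
  by apply: L_le => //; exact: ltW.
Qed.

(** The images of [[a, b]] along a shortest word have total length at most [2], being disjoint
    modulo 1; [1 + x <= exp x] turns the product of the step factors into [expR (2 * M)]. *)
Lemma wandering_distortion a b F : wandering a b -> L F ->
  slope_ratio_le (expR (2 * M)) a b F.
Proof.
move=> W LF; have ab : a < b by case: W.
have [n SF] := word_sphere_total a b LF.
have [f [_ Sf slF]] := word_sphere_slope ab SF.
have Lf k : (k <= n)%N -> L (f k) by move=> /Sf[/word_ball_L].
have sum2 : \sum_(k < n) (f k b - f k a) <= 2.
  apply: (@sum_disjoint_mod1 _ _ (fun k => f k a) (fun k => f k b)).
    by move=> k /ltnW/Lf/L_lt; exact.
  have preim k t : (k <= n)%N -> f k a < t < f k b ->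
      exists2 y, a < y < b & f k y = t.
    move=> /Lf Lk tk; have [g [Lg _ gK]] := L_inv Lk.
    by exists (g t); rewrite ?gK// -(L_ltE Lk) gK -[X in _ && X](L_ltE Lk) gK.
  move=> i j m x /ltnW ilt /ltnW jlt /(preim _ _ ilt)[y yab yx].
  move=> /(preim _ _ jlt)[z zab zx].
  have e : f j z = f i y + m%:~R by rewrite yx zx.
  have ij := word_sphere_disjoint W (Sf _ jlt) (Sf _ ilt) zab yab e.
  split => //; subst j.
  (* With [i = j] the map agrees on [[a, b]] with its own translate by [m], so [m = 0]. *)
  have := wandering_eq W (Lf _ ilt) (L_addint m (Lf _ ilt)) zab yab e.
  move=> /(_ a); rewrite lexx ltW// => /(_ erefl) /eqP.
  by rewrite -subr_eq0 opprD addNKr oppr_eq0 intr_eq0 => /eqP.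
have prod_le : \prod_(k < n) (1 + M * (f k b - f k a)) <= expR (2 * M).
  apply: (@le_trans _ _ (expR (\sum_(k < n) (M * (f k b - f k a))))).
    rewrite expR_sum; apply: ler_prod => k _.
    rewrite expR_ge1Dx andbT addr_ge0// mulr_ge0// subr_ge0.
    by apply: L_le (Lf _ (ltnW (ltn_ord k))) _ _ (ltW ab).
  by rewrite ler_expR -mulr_sumr mulrC ler_wpM2r.
exact: slope_ratio_leW slF.
Qed.

End Distortion.

(** * The equivariant bi-Lipschitz map *)

Section Equivariant_map.
Variable C : R.
Hypothesis C_ge1 : 1 <= C.
Hypothesis distortion : forall a b F, wandering a b -> L F ->
  slope_ratio_le C a b F.
Hypothesis wandering_dense : forall a b, a < b -> exists c d,
  [/\ a <= c, d <= b & wandering c d].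
Hypothesis L_derivable : forall F t, L F -> derivable F t 1.

Definition saturation (p : R * R) : set R :=
  [set x | exists F y, [/\ L F, p.1 < y < p.2 & x = F y]].

Variable G : R -> R.
Hypothesis G_slope : forall x y, x <= y ->
  2^-1 * (y - x) <= G y - G x <= 3 / 2 * (y - x).
Hypothesis G_corner : forall a b, a < b -> exists x, a < x < b /\
    forall d c, 0 < c -> ~ derivable (fun t => d + c * G t) x 1.

(** [D] keeps one interval per orbit: the saturations are pairwise disjoint, and maximality will
    make their union dense. *)
Variable D : set (R * R).
Hypothesis D_maximal : maximal_disjoint_subcollection saturation D
  [set p | wandering p.1 p.2].

Let D_wandering p : D p -> wandering p.1 p.2.
Proof. by case: D_maximal => + _ _ => /[apply]. Qed.

Let D_lt p : D p -> p.1 < p.2. Proof. by move=> /D_wandering[]. Qed.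

Let D_disjoint p q F H y z : D p -> D q -> L F -> L H ->
  p.1 < y < p.2 -> q.1 < z < q.2 -> F y = H z -> p = q.
Proof.
move=> Dp Dq LF LH py qz e; case: D_maximal => _ triv _; apply: triv => //.
by exists (F y); split; [exists F, y|exists H, z].
Qed.

(** The affine rescaling of [G] that fixes both ends of [p]. *)
Definition bend (p : R * R) (y : R) : R :=
  p.1 + (p.2 - p.1) / (G p.2 - G p.1) * (G y - G p.1).

Let bend_coef p : p.1 < p.2 ->
  2 / 3 <= (p.2 - p.1) / (G p.2 - G p.1) <= 2 /\ 0 < G p.2 - G p.1.
Proof.
move=> p12; have /andP[lo hi] := G_slope (ltW p12).
have G0 : 0 < G p.2 - G p.1 by lra.
by split => //; rewrite ler_pdivlMr// ler_pdivrMr//; apply/andP; split; lra.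
Qed.

Let bend1 p : bend p p.1 = p.1.
Proof. by rewrite /bend subrr mulr0 addr0. Qed.

Let bend2 p : p.1 < p.2 -> bend p p.2 = p.2.
Proof.
by move=> /bend_coef[_ G0]; rewrite /bend divfK ?gt_eqF// addrC subrK.
Qed.

Let bend_slope p y z : p.1 < p.2 -> y <= z ->
  3^-1 * (z - y) <= bend p z - bend p y <= 3 * (z - y).
Proof.
move=> /bend_coef[/andP[c1 c2] _] yz.
rewrite (_ : bend p z - bend p y = (p.2 - p.1) / (G p.2 - G p.1) * (G z - G y)).
  have /andP[g1 g2] := G_slope yz; apply/andP; split; nra.
by rewrite /bend; ring.
Qed.

Let bend_lt p y z : p.1 < p.2 -> y < z -> bend p y < bend p z.
Proof. by move=> p12 yz; have := bend_slope p12 (ltW yz); lra. Qed.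

Let bend_itv p y : p.1 < p.2 -> p.1 <= y <= p.2 -> p.1 <= bend p y <= p.2.
Proof.
move=> p12 /andP[py yp].
have := bend_slope p12 py; have := bend_slope p12 yp.
by rewrite bend1 bend2//; lra.
Qed.

(** On the image of [p] under [F] this is [bend p] conjugated by [F]. The value is picked by [xget],
    with default [x] off the support. *)
Definition bent : R -> R := fun x =>
  xget x [set x' | exists p F y,
    [/\ D p, L F, p.1 < y < p.2, x = F y & x' = F (bend p y)]].

Definition bent_support : set R := \bigcup_(p in D) saturation p.

Let bent_fix x : ~ bent_support x -> bent x = x.
Proof.
move=> nx; apply: xgetPN => x' [p [F [y [Dp LF py xE _]]]].
by apply: nx; exists p => //; exists F, y.
Qed.

(** The value does not depend on the choice: if [F y = H z], disjointness of saturations gives the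
    same [p], and then [F] and [H] agree on all of [p] by [wandering_eq]. *)
Let bentE_in p F y : D p -> L F -> p.1 < y < p.2 ->
  bent (F y) = F (bend p y).
Proof.
move=> Dp LF py; apply: xget_unique => [|x' [q [H [z [Dq LH qz e ->]]]]].
  by exists p, F, y.
have pq := D_disjoint Dp Dq LF LH py qz e; subst q.
have FH := wandering_eq (D_wandering Dp) LF LH py qz e.
have itv t : p.1 < t < p.2 -> p.1 <= t <= p.2 by move=> /andP[/ltW-> /ltW->].
have -> : z = y by apply: (L_inj LH); rewrite -e FH// itv.
by rewrite FH//; apply: bend_itv; rewrite ?D_lt ?itv.
Qed.

(** If [F x] lay inside an image of some [q] in [D], points of the open interval [p] near [x] would
    land there too, so [p = q]. Since [p] is wandering, [K \o F] would fix [x], which is not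
    interior to [p]. *)
Let endpoint_disjoint p F x : D p -> L F -> x = p.1 \/ x = p.2 ->
  ~ bent_support (F x).
Proof.
move=> Dp LF xp [q Dq [H [y [LH qy e]]]].
have p12 := D_lt Dp.
have [K [LK HK KH]] := L_inv LH.
have LKF := L_comp LK LF.
have [E [LE KFE EKF]] := L_inv LKF.
have KFx : (K \o F) x = y by rewrite /= e HK.
have [t tx /andP[pt qt]] : exists2 t, t != x &
    (p.1 < t < p.2) && (q.1 < (K \o F) t < q.2).
  have Eq t : (q.1 < (K \o F) t < q.2) = (E q.1 < t < E q.2).
    by rewrite -(L_ltE LE) -[X in _ && X](L_ltE LE) KFE.
  have := qy; rewrite -KFx Eq => /andP[E1 E2].
  case: xp => xp; rewrite xp in E1 E2 *.
    have lt1 : p.1 < Num.min p.2 (E q.2) by rewrite lt_min p12.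
    exists ((p.1 + Num.min p.2 (E q.2)) / 2); first by rewrite gt_eqF//; lra.
    have : Num.min p.2 (E q.2) <= p.2 by rewrite ge_min lexx.
    have : Num.min p.2 (E q.2) <= E q.2 by rewrite ge_min lexx orbT.
    by rewrite Eq; move=> *; apply/andP; split; apply/andP; split; lra.
  have lt2 : Num.max p.1 (E q.1) < p.2 by rewrite gt_max p12.
  exists ((p.2 + Num.max p.1 (E q.1)) / 2); first by rewrite lt_eqF//; lra.
  have : p.1 <= Num.max p.1 (E q.1) by rewrite le_max lexx.
  have : E q.1 <= Num.max p.1 (E q.1) by rewrite le_max lexx orbT.
  by rewrite Eq; move=> *; apply/andP; split; apply/andP; split; lra.
have pq : p = q.
  by apply: (@D_disjoint p q (K \o F) id t ((K \o F) t)).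
subst q; have [_ W] := D_wandering Dp.
have := W _ _ LKF pt qt x; rewrite KFx => yx.
have pxp : p.1 <= x <= p.2 by case: xp => ->; rewrite lexx (ltW p12).
by move: qy; rewrite (yx pxp); case: xp => ->; rewrite ltxx ?andbF.
Qed.

Let bentE p F y : D p -> L F -> p.1 <= y <= p.2 -> bent (F y) = F (bend p y).
Proof.
move=> Dp LF /andP[py yp].
have p12 := D_lt Dp.
have [->|y1] := eqVneq y p.1.
  by rewrite bend1 bent_fix//; apply: (endpoint_disjoint Dp) => //; left.
have [->|y2] := eqVneq y p.2.
  by rewrite bend2// bent_fix//; apply: (endpoint_disjoint Dp) => //; right.
by apply: bentE_in => //; rewrite !lt_neqAle py yp eq_sym y1 y2.
Qed.

Lemma bent_equivariant F x : L F -> bent (F x) = F (bent x).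
Proof.
move=> LF; have [[p Dp [H [y [LH py ->]]]]|nx] := pselect (bent_support x).
  by rewrite (bentE_in Dp LH py); exact: (bentE_in Dp (L_comp LF LH) py).
rewrite (bent_fix nx) bent_fix// => -[p Dp [H [y [LH py e]]]].
have [K [LK FK KF]] := L_inv LF.
apply: nx; exists p => //; exists (K \o H), y; split => //; first exact: L_comp.
by rewrite /= -e FK.
Qed.

Let bent_bounds x y : Prop :=
  y - x <= 3 * C * (bent y - bent x) /\ bent y - bent x <= 3 * C * (y - x).

(** Conjugation by [F] compares two difference quotients of [F] on [p]; their ratio is at most [C]
    by distortion, and [bend p] itself contributes the factor [3]. *)
Let bent_local p F y z : D p -> L F -> p.1 <= y <= p.2 -> p.1 <= z <= p.2 ->
  y <= z -> bent_bounds (F y) (F z).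
Proof.
move=> Dp LF py pz; have p12 := D_lt Dp.
rewrite le_eqVlt /bent_bounds => /predU1P[->|yz].
  by rewrite !subrr !mulr0.
rewrite !(bentE Dp LF)//.
have /andP[b1 b2] := bend_slope p12 (ltW yz).
have b_lt := bend_lt p12 yz.
have py' := bend_itv p12 py; have pz' := bend_itv p12 pz.
have slF := distortion (D_wandering Dp) LF.
have := slF _ _ _ _ pz' py' pz py; have := slF _ _ _ _ pz py pz' py'.
have := L_lt LF yz; have := L_lt LF b_lt.
move: b1 b2 b_lt yz; rewrite -subr_gt0 -[y < z]subr_gt0.
rewrite -[F (bend _ _) < _]subr_gt0 -[F _ < F z]subr_gt0.
set B := bend p z - _; set Z := z - y; set FB := F (bend p z) - _.
set FZ := F z - _ => b1 b2 B0 Z0 FB0 FZ0.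
rewrite !gtr0_norm// => h1 h2; split.
  rewrite -(ler_pM2r B0); apply: le_trans h1 _.
  have := ler_wpM2l (ltW FB0) b1.
  move=> /(ler_wpM2l (le_trans ler01 C_ge1)); lra.
rewrite -(ler_pM2r Z0); apply: le_trans h2 _.
have := ler_wpM2l (ltW FZ0) b2.
move=> /(ler_wpM2l (le_trans ler01 C_ge1)); lra.
Qed.

(** [hi] is the right end of the interval of the support around [x], or [x] itself off the support.
    Up to [hi] only one conjugate of [bend] is involved. *)
Let bent_right x : exists hi, [/\ x <= hi, ~ bent_support hi,
  forall z, x <= z < hi -> bent_support z &
  forall z, x <= z <= hi -> bent_bounds x z].
Proof.
have [[p Dp [F [y [LF py ->]]]]|nx] := pselect (bent_support x); last first.
  exists x; split => // z.
    by move=> /andP[xz zx]; move: (le_lt_trans xz zx); rewrite ltxx.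
  by move=> /le_anti <-; rewrite /bent_bounds !subrr !mulr0.
have [K [LK FK KF]] := L_inv LF; have p12 := D_lt Dp.
case/andP: py => p1y yp2.
have pre z : F y <= z -> exists2 t, y <= t & z = F t.
  by move=> Fyz; exists (K z); rewrite ?KF// -(L_leE LF) KF.
exists (F p.2); split.
- by rewrite (L_leE LF) ltW.
- by apply: (endpoint_disjoint Dp) => //; right.
- move=> z /andP[/pre[t yt ->]]; rewrite (L_ltE LF) => tp.
  by exists p => //; exists F, t; split => //; rewrite (lt_le_trans p1y yt).
- move=> z /andP[/pre[t yt ->]]; rewrite (L_leE LF) => tp.
  by apply: (bent_local Dp) => //; rewrite ?(ltW p1y) ?(ltW yp2)//
    (le_trans (ltW p1y) yt).
Qed.

Let bent_left y : exists lo, [/\ lo <= y, ~ bent_support lo &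
  forall z, lo <= z <= y -> bent_bounds z y].
Proof.
have [[p Dp [F [x [LF px ->]]]]|ny] := pselect (bent_support y); last first.
  exists y; split => // z.
  by move=> /le_anti <-; rewrite /bent_bounds !subrr !mulr0.
have [K [LK FK KF]] := L_inv LF; have p12 := D_lt Dp.
case/andP: px => p1x xp2.
exists (F p.1); split.
- by rewrite (L_leE LF) ltW.
- by apply: (endpoint_disjoint Dp) => //; left.
- move=> z; rewrite -[z]KF !(L_leE LF) => /andP[pz zx].
  by apply: (bent_local Dp) => //; rewrite ?(ltW p1x) ?(ltW xp2)//
    pz (le_trans zx (ltW xp2)).
Qed.

(** Cut at the right end [hi] of the interval around [x] and at the left end [lo] of the one around
    [y]. Both cuts are fixed by [bent], so the increment between them is exactly [lo - hi], and the
    outer pieces obey the local bounds. *)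
Lemma bent_bilipschitz x y : x < y ->
  y - x <= 3 * C * (bent y - bent x) /\ bent y - bent x <= 3 * C * (y - x).
Proof.
move=> xy; have [hi [xhi nhi mid Phi]] := bent_right x.
have [lo [loy nlo Plo]] := bent_left y.
have [yhi|hiy] := leP y hi; first by apply: Phi; rewrite (ltW xy).
have [lox|xlo] := leP lo x; first by apply: Plo; rewrite lox ltW.
have [hilo|lohi] := leP hi lo; last first.
  by case: nlo; apply: mid; rewrite lohi ltW.
have [|h1 h2] := Phi hi; first by rewrite xhi lexx.
have [|h3 h4] := Plo lo; first by rewrite loy lexx.
move: h1 h2 h3 h4; rewrite (bent_fix nhi) (bent_fix nlo) => h1 h2 h3 h4.
have h5 : lo - hi <= 3 * C * (lo - hi).
  by rewrite ler_peMl ?subr_ge0//; move: C_ge1; lra.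
split; lra.
Qed.

Lemma bent_continuous : continuous bent.
Proof.
have K0 : 0 < 3 * C by rewrite mulr_gt0// (lt_le_trans ltr01).
move=> x; apply/cvgrPdist_lt => e e0.
exists (e / (3 * C)); first by rewrite /= divr_gt0.
move=> y /=; rewrite ltr_pdivlMr//; apply: le_lt_trans; rewrite mulrC.
have hlt u v : u < v -> `|bent v - bent u| <= 3 * C * `|v - u|.
  move=> uv; have [h1 h2] := bent_bilipschitz uv.
  rewrite [in leRHS]gtr0_norm ?subr_gt0// ger0_norm//.
  by rewrite -(pmulr_rge0 _ K0); apply: le_trans h1; rewrite subr_ge0 ltW.
have [xy|xy|->] := ltgtP x y; last by rewrite !subrr normr0 mulr0.
  by rewrite distrC (distrC x) hlt.
exact: hlt.
Qed.

(** [bent] commutes with integer translations, so [m] can be chosen with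
    [bent m <= y < bent (m + 1)]. *)
Lemma bent_surjective y : exists x, bent x = y.
Proof.
pose m := Num.floor (y - bent 0).
have bm (k : int) : bent k%:~R = bent 0 + k%:~R.
  by rewrite -[in LHS](add0r k%:~R) (bent_equivariant _ (L_shift k)).
have := floor_itv (y - bent 0); rewrite -/m => /andP[m1 m2].
have mm : m%:~R <= (m + 1)%:~R :> R by rewrite ler_int lerDl.
have bmm : bent m%:~R <= bent (m + 1)%:~R by rewrite !bm lerD2l.
have [|x _ <-] := IVT mm (continuous_subspaceT bent_continuous) (v := y).
  by rewrite min_l// max_r// !bm; apply/andP; split; lra.
by exists x.
Qed.

(** A wandering interval inside []a, b[] that the support misses could be added to [D], against
    maximality. *)
Let bent_support_dense a b : a < b -> exists p F y,
  [/\ D p, L F, p.1 < y < p.2 & a < F y < b].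
Proof.
move=> /wandering_dense[c [d [ac db W]]]; apply: contrapT => none.
have out p F y : D p -> L F -> p.1 < y < p.2 -> ~ c < F y < d.
  move=> Dp LF py /andP[cy yd]; apply: none; exists p, F, y; split => //.
  by rewrite (le_lt_trans ac cy) (lt_le_trans yd db).
have [Dsub Dtriv Dmax] := D_maximal; have cd : c < d by case: W.
apply: (Dmax (D `|` [set (c, d)])).
- split; first by move=> p; left.
  move=> /(_ (c, d)) Dcd; apply: (@out (c, d) id ((c + d) / 2)) => //=.
  + by apply: Dcd; right.
  + by apply/andP; split; lra.
  + by apply/andP; split; lra.
- by move=> p [/Dsub|->].
- have disj p : D p -> saturation p `&` saturation (c, d) !=set0 -> False.
    move=> Dp [_ [[F [y [LF py ->]]] [H [z [LH zcd e]]]]].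
    have [K [LK HK KH]] := L_inv LH.
    apply: (out p (K \o F) y) => //; first exact: L_comp.
    by rewrite /= e HK.
  move=> p q [Dp|->] [Dq|->] // pq; first exact: Dtriv.
  + by case: (disj p).
  + by case: (disj q) => //; rewrite setIC.
Qed.

(** Some [F] in [L] carries part of an interval [p] of [D] into []a, b[]. On that part [bent] is an
    affine rescaling of [G] and has a corner, which conjugation by [F] carries to []a, b[]. *)
Lemma bent_not_derivable a b : a < b ->
  exists x, a < x < b /\ ~ derivable bent x 1.
Proof.
move=> /bent_support_dense[p [F [y [Dp LF /andP[py yp] /andP[aFy Fyb]]]]].
have [K [LK FK KF]] := L_inv LF; have p12 := D_lt Dp.
have lt_ab : Num.max p.1 (K a) < Num.min p.2 (K b).
  rewrite lt_min !gt_max p12 (L_ltE LK) (lt_trans aFy Fyb) andbT/=.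
  rewrite -(L_ltE LF) KF (lt_trans aFy) ?(L_ltE LF)//.
  by rewrite -[p.1 < _](L_ltE LF) KF (lt_trans _ Fyb)// (L_ltE LF).
have [x [/andP[]]] := G_corner lt_ab.
rewrite gt_max lt_min => /andP[px ax] /andP[xp xb] corner.
exists (F x); split.
  by rewrite -[a]KF -[b]KF !(L_ltE LF) ax xb.
move=> dFx.
have conj : bent = K \o bent \o F.
  by apply/funext => t /=; rewrite bent_equivariant// FK.
have : derivable bent x 1.
  rewrite conj; apply/derivable1_diffP/differentiable_comp.
    by apply/derivable1_diffP/L_derivable.
  apply: differentiable_comp; first exact/derivable1_diffP.
  by apply/derivable1_diffP/L_derivable.
pose k := (p.2 - p.1) / (G p.2 - G p.1).
have [/andP[k0 _] _] := bend_coef p12.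
move=> dx; apply: (corner (p.1 - k * G p.1) k).
  by apply: lt_le_trans k0; rewrite divr_gt0.
apply: near_eq_derivable dx.
have : x \in `]p.1, p.2[ by rewrite in_itv/= px.
move=> /near_in_itvoo; apply: filterS => t; rewrite in_itv/= => pt.
by rewrite (@bentE_in p id)// /bend -/k; ring.
Qed.
End Equivariant_map.
End Group_of_lifts.

(** * The group of lifts *)

(** Two distinct integer values would force, by the intermediate value theorem, the value [1/2]
    above the smaller one. *)
Lemma continuous_int_constant (R : realType) (f : R -> R) : continuous f ->
  (forall t, f t \is a Num.int) -> forall s t, f s = f t.
Proof.
move=> cf fint.
have lt_absurd s t : s <= t -> f s = f t.
  move=> st; apply: contrapT => /eqP nst.
  have [/intrP[k fk] /intrP[l fl]] := (fint s, fint t).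
  have kl : k != l by apply: contra nst; rewrite fk fl => /eqP ->.
  have [|x _ fx] := IVT st (continuous_subspaceT cf)
      (v := (Num.min k l)%:~R + 2^-1).
    rewrite fk fl; case: (ltgtP k l) kl => // kl _;
      move: kl; rewrite -lezD1 -(ler_int R) intrD => kl.
      by rewrite min_l ?max_r; lra.
    by rewrite min_r ?max_l; lra.
  have /intrP[j] := fint x; rewrite fx => e.
  have : (Num.min k l)%:~R < j%:~R :> R by lra.
  have : j%:~R < (Num.min k l + 1)%:~R :> R by rewrite intrD; lra.
  by rewrite !ltr_int; lia.
by move=> s t; case: (leP s t) => [/lt_absurd|/ltW/lt_absurd].
Qed.

Lemma is_lift_unique (R : realType) (f : circle R -> circle R) (F G : R -> R) :
  is_lift F f -> is_lift G f -> exists m : int, forall t, F t = G t + m%:~R.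
Proof.
move=> [cF Ff] [cG Gf].
have FGint t : F t - G t \is a Num.int by apply/projP; rewrite -Ff -Gf.
have /intrP[m Fm] := FGint 0; exists m => t.
rewrite -Fm (@continuous_int_constant _ (fun t => F t - G t) _ FGint 0 t).
  by rewrite addrC subrK.
by move=> x; apply: cvgB; [exact: cF|exact: cG].
Qed.

Lemma derive1_addr (R : realType) (f : R -> R) (c d t : R) :
  (forall s, f (s + c) = f s + d) -> (f^`() (t + c) = f^`() t)%classic.
Proof.
move=> fcd; rewrite /derive1.
rewrite (_ : (fun h => _) = fun h => h^-1 *: (f (h + t) - f t))//.
by apply/funext => h; rewrite addrA !fcd; congr (_ *: _); ring.
Qed.

Lemma derivable_mean_value (R : realType) (f : R -> R) (a b x y : R) :
  (forall t, derivable f t 1) -> a <= x <= b -> a <= y <= b ->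
  exists2 c, a <= c <= b & f x - f y = (f^`() c)%classic * (x - y).
Proof.
move=> df; wlog yx : x y / y <= x => [wl|] xab yab.
  have [/wl|/ltW/wl] := leP y x; first exact.
  move=> /(_ yab xab)[c cab e]; exists c => //.
  by rewrite -[LHS]opprB e -mulrN opprB.
have drv t : t \in `]y, x[ -> is_derive t 1 f (f^`() t)%classic.
  by move=> _; rewrite derive1E; exact: derivableP.
have cf : {within `[y, x], continuous f}.
  by apply: derivable_within_continuous => t _; exact: df.
have [c] := MVT_segment yx drv cf; rewrite in_itv/= => /andP[yc cx] e.
exists c => //; case/andP: xab => _ xb; case/andP: yab => ay _.
by rewrite (le_trans ay yc) (le_trans cx xb).
Qed.

(** The natural exponents [m] and [n] encode the integer exponent [m - n]; such words are closed
    under composition because [f] and its inverse commute. *)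
Lemma cyclic_powers (T : Type) (f g : T -> T) : cancel f g -> cancel g f ->
  generated_group [set f] `<=`
  [set h | exists m n, h = iter m f \o iter n g].
Proof.
move=> fg gf.
have fgn n x : iter n f (iter n g x) = x.
  by elim: n x => // n IH x; rewrite iterSr /= gf IH.
have gfn n x : iter n g (iter n f x) = x.
  by elim: n x => // n IH x; rewrite iterSr /= fg IH.
have gfC m n x : iter m g (iter n f x) = iter n f (iter m g x).
  have [mn|/ltnW nm] := leqP m n.
    by rewrite -[in LHS](subnKC mn) iterD gfn -[in RHS](subnK mn) iterD fgn.
  by rewrite -[in LHS](subnK nm) iterD gfn -[in RHS](subnKC nm) iterD fgn.
apply: smallest_sub => [|_ ->]; last by exists 1%N, 0%N.
split.
- by exists 0%N, 0%N.
- move=> _ _ [m [n ->]] [p [q ->]]; exists (m + p)%N, (n + q)%N.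
  by apply/funext => x /=; rewrite gfC !iterD.
- move=> _ [m [n ->]]; exists (iter n f \o iter m g); split.
  + by exists n, m.
  + by move=> x /=; rewrite gfn fgn.
  + by move=> x /=; rewrite gfn fgn.
Qed.

Section Lifts.
Variables (R : realType) (Gamma : set (circle R -> circle R)).
Hypothesis Gamma_group : transformation_group Gamma.
Hypothesis Gamma_diffeo :
  forall g, Gamma g -> Ck_diffeo 2 g /\ orientation_preserving g.

Definition increasing_lift (g : circle R -> circle R) (F : R -> R) : Prop :=
  is_lift F g /\ {homo F : s t / s < t}.

Definition lifts : set (R -> R) :=
  [set F | exists2 g, Gamma g & increasing_lift g F].

Let increasing_lift_addint g F (m : int) : increasing_lift g F ->
  increasing_lift g (fun t => F t + m%:~R).
Proof.
move=> [[cF Fg] incF]; split; last by move=> s t /incF; rewrite ltrD2r.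
split; first by move=> t; apply: cvgD; [exact: cF|exact: cvg_cst].
by move=> t; rewrite Fg; apply/projP; rewrite opprD addNKr rpredN intr_int.
Qed.

Let increasing_lift_comp f g F G : increasing_lift f F -> increasing_lift g G ->
  increasing_lift (f \o g) (F \o G).
Proof.
move=> [[cF Ff] incF] [[cG Gg] incG]; split; last by move=> s t /incG/incF.
split; first by move=> t; apply: continuous_comp; [exact: cG|exact: cF].
by move=> t /=; rewrite Gg Ff.
Qed.

Let increasing_lift_id : increasing_lift id id.
Proof. by split => //; split => // t; exact: cvg_id. Qed.

Lemma increasing_lift_unique g F G :
  increasing_lift g F -> increasing_lift g G ->
  exists m : int, F = (fun t => G t + m%:~R).
Proof.
move=> [Fg _] [Gg _]; have [m FG] := is_lift_unique Fg Gg.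
by exists m; apply/funext.
Qed.

(** Any increasing lift of [g] composed with [F] lifts the identity, hence is an integer
    translation; subtracting that integer gives the inverse. *)
Let increasing_lift_inv f g F : cancel f g -> cancel g f -> Gamma g ->
  increasing_lift f F ->
  exists G, [/\ increasing_lift g G, cancel F G & cancel G F].
Proof.
move=> fg gf /Gamma_diffeo[_ [G0 [G0g G0inc]]] Ff.
have {}G0g : increasing_lift g G0 by [].
have [m G0F] : exists m : int, G0 \o F = (fun t => t + m%:~R).
  apply: (@increasing_lift_unique id _ id) => //.
  rewrite (_ : id = g \o f); first exact: increasing_lift_comp.
  by apply/funext => x /=; rewrite fg.
pose G t := G0 t + (- m)%:~R; exists G.
have Gg : increasing_lift g G by exact: increasing_lift_addint.
have FK : cancel F G.
  by move=> t; rewrite /G -[G0 (F t)]/((G0 \o F) t) G0F intrN addrK.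
split => // t.
have [n FGn] : exists n : int, F \o G = (fun t => t + n%:~R).
  apply: (@increasing_lift_unique id _ id) => //.
  rewrite (_ : id = f \o g); first exact: increasing_lift_comp.
  by apply/funext => x /=; rewrite gf.
have /(congr1 (fun h => h (F 0))) := FGn; rewrite /= FK => F0n.
have {F0n} n0 : n%:~R = 0 :> R.
  by move: F0n => /eqP; rewrite -subr_eq0 opprD addNKr oppr_eq0 => /eqP.
by have /(congr1 (fun h => h t)) := FGn; rewrite /= n0 addr0.
Qed.

Lemma lifts_group : transformation_group lifts.
Proof.
have [Gid Gcomp Ginv] := Gamma_group; split.
- by exists id.
- move=> F G [f Gf Ff] [g Gg Gg']; exists (f \o g); first exact: Gcomp.
  exact: increasing_lift_comp.
- move=> F [f Gf Ff]; have [g [Gg fg gf]] := Ginv _ Gf.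
  have [G [Gg' FG GF]] := increasing_lift_inv fg gf Gg Ff.
  by exists G; split => //; exists g.
Qed.

Lemma lifts_lt F : lifts F -> {homo F : s t / s < t}.
Proof. by move=> [g _ []]. Qed.

Lemma lifts_continuous F : lifts F -> continuous F.
Proof. by move=> [g _ [[]]]. Qed.

Lemma lifts_shift (m : int) : lifts (fun t => t + m%:~R).
Proof.
have [Gid _ _] := Gamma_group; exists id => //.
exact: increasing_lift_addint increasing_lift_id.
Qed.

Let shift1_lift g F : increasing_lift g F -> exists2 p : int, 1 <= p &
  forall t, F (t + 1) = F t + p%:~R.
Proof.
move=> Fg; have [[cF Fgp] incF] := Fg.
have F1g : increasing_lift g (fun t => F (t + 1)).
  split; last by move=> s t st; apply: incF; rewrite ltrD2r.
  split=> [t|t].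
    apply: (@continuous_comp _ _ _ (fun t : R => t + 1) F); last exact: cF.
    by apply: cvgD; [exact: cvg_id|exact: cvg_cst].
  by rewrite -Fgp; congr g; apply/projP; rewrite opprD addNKr rpredN rpred1.
have [p Fp] := increasing_lift_unique F1g Fg; exists p.
  have : F 0 < F (0 + 1) by apply: incF; rewrite ltrDl.
  rewrite -[F (0 + 1)]/((fun t => F (t + 1)) 0) Fp ltrDl.
  by rewrite ltr0z gtz0_ge1.
by move=> t; rewrite -[LHS]/((fun t => F (t + 1)) t) Fp.
Qed.

(** The degrees [p] of [F] and [q] of its inverse [G] are integers at least [1]; if [p > 1],
    applying [G] to [F s + 1 < F (s + 1)] gives [s + q < s + 1]. *)
Lemma lifts_degree F (m : int) t : lifts F -> F (t + m%:~R) = F t + m%:~R.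
Proof.
move=> LF; have [_ _ /(_ _ LF)[G [LG FG GF]]] := lifts_group.
have F1 s : F (s + 1) = F s + 1.
  have [f _ /shift1_lift[p p1 Fp]] := LF.
  have [g _ /shift1_lift[q q1 Gq]] := LG.
  rewrite Fp; congr (_ + _); apply/eqP; rewrite eq_le ler1z -(ler1z R) in p1 *.
  rewrite p1 andbT leNgt; apply/negP => p_gt1.
  have : G (F s + 1) < G (F s + p%:~R).
    by apply: lifts_lt LG _ _ _; rewrite ltrD2l.
  by rewrite -Fp Gq !FG ltrD2l ltNge ler1z q1.
have Fn (n : nat) s : F (s + n%:R) = F s + n%:R.
  by elim: n => [|n IH]; rewrite ?addr0// -natr1 !addrA F1 IH.
case: m => n; first exact: Fn.
by rewrite NegzE intrN -[in RHS](subrK (n.+1%:R) t) Fn addrK.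
Qed.

Lemma lifts_C2 F : lifts F ->
  [/\ forall t, derivable F t 1, forall t, derivable F^`()%classic t 1
    & continuous F^`()^`()%classic].
Proof.
move=> [g /Gamma_diffeo[[_ [_ _ [F0 [F0g [dF0 cF0]]] _]] _] [Fg _]].
have [m FE] := is_lift_unique Fg F0g.
have -> : F = (fun t => F0 t + m%:~R) by exact/funext.
have F'E : (fun t => F0 t + m%:~R)^`()%classic = F0^`()%classic.
  apply/funext => t; rewrite /derive1.
  rewrite (_ : (fun h => _) = fun h => h^-1 *: (F0 (h + t) - F0 t))//.
  by apply/funext => h; congr (_ *: _); ring.
split.
- by move=> t; apply: derivableD; [exact: (dF0 0%N)|exact: derivable_cst].
- by rewrite F'E => t; exact: (dF0 1%N).
- by rewrite F'E; exact: cF0.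
Qed.

(** The constant is [max |F''| / min |F'|], a bound on the derivative of [log |F'|]: [F'] vanishes
    nowhere, as the inverse is differentiable, and [F'] and [F''] are 1-periodic. By the mean value
    theorem, difference quotients are values of [F']. *)
Lemma lifts_slope_ratio F : lifts F -> exists2 M : R, 0 <= M &
  forall a b, a <= b -> slope_ratio_le (1 + M * (b - a)) a b F.
Proof.
move=> LF; have [dF dF' cF''] := lifts_C2 LF.
have [_ _ /(_ _ LF)[G [LG FG _]]] := lifts_group; have [dG _ _] := lifts_C2 LG.
have F'_neq0 t : (F^`() t)%classic != 0.
  have := derive1_comp (dF t) (dG (F t)).
  rewrite (_ : G \o F = id); last exact/funext.
  by rewrite derive1_id; apply: contra_eqN => /eqP ->; rewrite mulr0 oner_eq0.
have shiftF (k : int) u : F (u + k%:~R) = F u + k%:~R by exact: lifts_degree.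
have shiftF' (k : int) u : derive1 F (u + k%:~R) = derive1 F u + 0.
  by rewrite addr0 (derive1_addr _ (shiftF k)).
have per t : exists2 s, s \in `[0, 1] & (F^`() t = F^`() s)%classic /\
    (F^`()^`() t = F^`()^`() s)%classic.
  exists (t - (Num.floor t)%:~R).
    have := floor_itv t; rewrite in_itv/= intrD => /andP[? ?].
    by apply/andP; split; lra.
  rewrite -intrN; split; apply/esym; first exact: (derive1_addr _ (shiftF _)).
  exact: (derive1_addr _ (shiftF' _)).
have cF' : continuous (fun t => `|(F^`() t)%classic|).
  move=> t; apply: (@continuous_comp _ _ _ F^`()%classic Num.norm).
    by apply/differentiable_continuous/derivable1_diffP.
  exact: norm_continuous.
have cF2 : continuous (fun t => `|(F^`()^`() t)%classic|).
  move=> t; apply: (@continuous_comp _ _ _ F^`()^`()%classic Num.norm).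
    exact: cF''.
  exact: norm_continuous.
have [c _ minF'] := EVT_min ler01 (continuous_subspaceT cF').
have [d _ maxF''] := EVT_max ler01 (continuous_subspaceT cF2).
set m := `|(F^`() c)%classic| in minF'; set B := `|_ d| in maxF''.
have m0 : 0 < m by rewrite normr_gt0.
have B0 : 0 <= B by exact: normr_ge0.
exists (B / m); first by rewrite divr_ge0// ltW.
move=> a b ab x y u v xab yab uab vab.
have [xi xiab ->] := derivable_mean_value dF xab yab.
have [eta etaab ->] := derivable_mean_value dF uab vab.
have [zeta _ F''E] := derivable_mean_value dF' xiab etaab.
have m_le : m <= `|(F^`() eta)%classic|.
  by have [s s01 [-> _]] := per eta; exact: minF'.
have B_ge : `|(F^`()^`() zeta)%classic| <= B.
  by have [s s01 [_ ->]] := per zeta; exact: maxF''.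
have xieta : `|xi - eta| <= b - a.
  case/andP: xiab => ? ?; case/andP: etaab => ? ?.
  by rewrite ler_norml; apply/andP; split; lra.
suff h : `|(F^`() xi)%classic| <=
    (1 + B / m * (b - a)) * `|(F^`() eta)%classic|.
  rewrite !normrM -mulrA; move: h.
  set k := 1 + _; set e := `|F^`()%classic eta| => h.
  rewrite [leRHS](_ : _ = k * e * (`|x - y| * `|u - v|)); last by ring.
  by rewrite ler_wpM2r// mulr_ge0.
have F'xi : `|(F^`() xi)%classic| <= `|(F^`() eta)%classic| + B * (b - a).
  rewrite -lerBlDl; apply: le_trans (lerB_dist _ _) _.
  rewrite F''E normrM.
  exact: (ler_pM (normr_ge0 _) (normr_ge0 _) B_ge xieta).
apply: le_trans F'xi _; rewrite mulrDl mul1r lerD2l.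
rewrite [leRHS](_ : _ = B * (b - a) * (`|(F^`() eta)%classic| / m));
  last by ring.
by rewrite ler_peMr ?mulr_ge0 ?subr_ge0// ler_pdivlMr// mul1r.
Qed.

Let Gamma_slope g : Gamma g -> exists2 M : R, 0 <= M &
  forall F a b, increasing_lift g F -> a <= b ->
    slope_ratio_le (1 + M * (b - a)) a b F.
Proof.
move=> Gg; have [_ [F0 [F0g incF0]]] := Gamma_diffeo Gg.
have F0gi : increasing_lift g F0 by [].
have [|M M0 slF0] := @lifts_slope_ratio F0; first by exists g.
exists M => // F a b Fg ab x y u v xab yab uab vab.
have [m ->] := increasing_lift_unique Fg F0gi.
have shiftB s t : s + m%:~R - (t + m%:~R) = s - t :> R by ring.
by rewrite !shiftB; exact: slF0.
Qed.

(** [S] consists of the increasing lifts of the generators and of their inverses, so that composing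
    with [S] on the left reaches all of [lifts]. Finiteness of the generating set makes [M] uniform,
    and the lifts of one [g] share a constant because they differ by translations. *)
Lemma lifts_generators : finitely_generated Gamma ->
  exists (S : set (R -> R)) (M : R), [/\ S `<=` lifts,
    forall s (m : int), S s -> S (fun t => s t + m%:~R), 0 <= M,
    forall s a b, S s -> a <= b -> slope_ratio_le (1 + M * (b - a)) a b s &
    forall P : set (R -> R), (forall m : int, P (fun t => t + m%:~R)) ->
      (forall s F, S s -> P F -> P (s \o F)) -> lifts `<=` P].
Proof.
move=> [S0 [fin_S0 GammaE]]; have [Gid Gcomp Ginv] := Gamma_group.
have S0_Gamma : S0 `<=` Gamma by rewrite GammaE; exact: sub_gen_smallest.
pose sym g := Gamma g /\ (S0 g \/ exists2 f, S0 f & cancel f g /\ cancel g f).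
pose bounds f (M : R) := S0 f -> 0 <= M /\ forall g F a b,
  g = f \/ cancel f g /\ cancel g f -> increasing_lift g F -> a <= b ->
  slope_ratio_le (1 + M * (b - a)) a b F.
have [bound boundP] : {bound & forall f, bounds f (bound f)}.
  apply: choice => f; have [S0f|] := pselect (S0 f); last by exists 0.
  have [f' [Gf' ff' f'f]] := Ginv _ (S0_Gamma _ S0f).
  have [M M0 slM] := Gamma_slope (S0_Gamma _ S0f).
  have [M' M'0 slM'] := Gamma_slope Gf'.
  exists (M + M') => _; split; first exact: addr_ge0.
  move=> g F a b fg Fg ab; have ba0 : 0 <= b - a by rewrite subr_ge0.
  case: fg => [gf|[fg gf]].
    rewrite gf in Fg; apply: slope_ratio_leW (slM _ _ _ Fg ab).
    by rewrite lerD2l ler_wpM2r// lerDl.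
  have gf' : g = f' by apply/funext => x; rewrite -[in LHS](f'f x) fg.
  rewrite gf' in Fg; apply: slope_ratio_leW (slM' _ _ _ Fg ab).
  by rewrite lerD2l ler_wpM2r// lerDr.
have [M [M0 le_M]] : exists M, 0 <= M /\ forall f, S0 f -> bound f <= M.
  have /finite_seqP[s sE] : finite_set (bound @` S0) by exact: finite_image.
  have [M [M0 le_M]] : exists M, 0 <= M /\ forall x, x \in s -> x <= M.
    elim: s {sE} => [|x s [M [M0 IH]]]; first by exists 0.
    exists (Num.max x M); rewrite le_max M0 orbT; split => // y.
    by rewrite inE le_max => /predU1P[->|/IH ->]; rewrite ?lexx ?orbT.
  exists M; split => // f S0f; apply: le_M.
  have : (bound @` S0) (bound f) by exists f.
  by rewrite sE.
exists [set F | exists2 g, sym g & increasing_lift g F], M; split => //.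
- by move=> F [g [Gg _] Fg]; exists g.
- by move=> F m [g symg Fg]; exists g => //; exact: increasing_lift_addint.
- move=> F a b [g [Gg symg] Fg] ab.
  have [f S0f fg] : exists2 f, S0 f & g = f \/ cancel f g /\ cancel g f.
    case: symg => [S0g|[f S0f ?]]; last by exists f => //; right.
    by exists g => //; left.
  have [_ /(_ g F a b fg Fg ab)] := boundP _ S0f.
  apply: slope_ratio_leW; rewrite lerD2l ler_wpM2r ?subr_ge0//; exact: le_M.
move=> P Pshift Pstep.
(* An equivalence rather than an implication, so that [good] is stable under
   inversion; [Q] makes [P] invariant under integer translations. *)
pose Q F := forall m : int, P (fun t => F t + m%:~R).
have Q_P F : Q F -> P F.
  move=> /(_ 0); rewrite (_ : (fun t => _) = F)//.
  by apply/funext => t; rewrite addr0.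
have Q_addint F (m : int) : Q F -> Q (fun t => F t + m%:~R).
  move=> QF k.
  rewrite (_ : (fun t => _) = fun t => F t + (m + k)%:~R); first exact: QF.
  by apply/funext => t; rewrite intrD addrA.
have Q_step g G F : sym g -> increasing_lift g G -> Q F -> Q (G \o F).
  move=> symg Gg QF m; apply: (Pstep (fun t => G t + m%:~R)); last exact: Q_P.
  by exists g => //; exact: increasing_lift_addint.
pose good g := Gamma g /\ forall G F, increasing_lift g G -> Q F <-> Q (G \o F).
have good_group : transformation_group good.
  split.
  - split => // G F Gid'.
    have [m ->] := increasing_lift_unique Gid' increasing_lift_id.
    split => [|/(Q_addint _ (- m))]; first exact: Q_addint.
    by congr Q; apply/funext => t /=; rewrite intrN addrK.
  - move=> f g [Gf Qf] [Gg Qg]; split=> [|H F Hfg]; first exact: Gcomp.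
    have [_ [F0 [F0f incF0]]] := Gamma_diffeo Gf.
    have [_ [G0 [G0g incG0]]] := Gamma_diffeo Gg.
    have F0fi : increasing_lift f F0 by [].
    have G0gi : increasing_lift g G0 by [].
    have [m ->] := increasing_lift_unique Hfg (increasing_lift_comp F0fi G0gi).
    by rewrite (Qg _ F G0gi) (Qf _ (G0 \o F) (increasing_lift_addint m F0fi)).
  - move=> f [Gf Qf]; have [g [Gg fg gf]] := Ginv _ Gf; exists g; split => //.
    split => // G F /(increasing_lift_inv gf fg Gf)[H [Hf GH HG]].
    rewrite (Qf _ (G \o F) Hf) (_ : H \o (G \o F) = F)//.
    by apply/funext => t /=; rewrite GH.
have sub : Gamma `<=` good.
  rewrite [X in X `<=` _]GammaE; apply: smallest_sub => // f S0f.
  have Gf := S0_Gamma _ S0f; split => // F H Ff.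
  have symf : sym f by split => //; left.
  split; first exact: Q_step Ff.
  have [g [Gg fg gf]] := Ginv _ Gf.
  have [G [Gg' FG _]] := increasing_lift_inv fg gf Gg Ff.
  have symg : sym g by split => //; right; exists f.
  move=> /(Q_step _ _ _ symg Gg'); congr Q.
  by apply/funext => t /=; rewrite FG.
move=> F [g Gg Fg]; have [_ /(_ F id Fg)[QF _]] := sub _ Gg.
by apply/Q_P/QF => m; exact: Pshift.
Qed.

(** The interval from [x] to [F x] is a fundamental domain of [F]: a positive power pushes it beyond
    [F x] and a negative one below [x], so only the identity returns a point to it. *)
Let wandering_of_powers c d x (F G : R -> R) : lifts F -> cancel G F ->
  c < x < d -> x < F x ->
  (forall H y, lifts H -> c < y < d -> c < H y < d ->
     exists k, H =1 iter k F \/ H =1 iter k G) ->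
  exists c' d', [/\ c <= c', d' <= d & wandering lifts c' d'].
Proof.
move=> LF GF /andP[cx xd] xFx powers.
have iter_gt k y : x < y -> x < iter k F y.
  elim: k => // k IH xy; apply: lt_trans xFx _.
  exact: lifts_lt LF _ _ (IH xy).
have iter_gtS k y : x < y -> F x < iter k.+1 F y.
  by move=> xy; apply: lifts_lt LF _ _ _; exact: iter_gt.
exists x, (Num.min d (F x)); split; first exact: ltW.
  by rewrite ge_min lexx.
split; first by rewrite lt_min xd.
move=> H y LH /andP[xy]; rewrite lt_min => /andP[yd yF] /andP[xH].
rewrite lt_min => /andP[Hd HF] z _.
have [||k [Hk|Hk]] := powers H y LH; rewrite ?(lt_trans cx)//.
- case: k Hk => [->//|k Hk].
  have := lt_trans (iter_gtS k _ xy) _; rewrite -Hk => /(_ _ HF).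
  by rewrite ltxx.
- case: k Hk => [->//|k Hk].
  have FG n t : iter n F (iter n G t) = t.
    by elim: n t => // n IH t; rewrite iterSr /= GF IH.
  have := iter_gtS k _ xH; rewrite Hk FG => Fy.
  by have := lt_trans Fy yF; rewrite ltxx.
Qed.

Let fixing_lift g (a : R) : Gamma g -> g (proj a) = proj a ->
  exists2 F, increasing_lift g F & F a = a.
Proof.
move=> Gg ga; have [_ [F [Fg incF]]] := Gamma_diffeo Gg.
have /projP/intrP[m am] : proj a = proj (F a) by have [_ <-] := Fg.
exists (fun t => F t + m%:~R); last by rewrite -am addrC subrK.
exact: increasing_lift_addint.
Qed.

Let increasing_lift_agree g F G (a : R) : increasing_lift g F ->
  increasing_lift g G -> F a = G a -> F = G.
Proof.
move=> Fg Gg Fa; have [m FE] := increasing_lift_unique Fg Gg.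
have m0 : m%:~R = 0 :> R.
  by move: Fa => /eqP; rewrite FE -subr_eq0 addrAC subrr add0r => /eqP.
by rewrite FE m0; apply/funext => t; rewrite addr0.
Qed.

(** * Wandering intervals from a non-dense orbit *)

Hypothesis Gamma_stab : forall p : circle R,
  stabilizer Gamma p = [set id] \/ infinite_cyclic (stabilizer Gamma p).

(** Let [a] be the last point of [K] up to [c]. A lift that returns a point of []c, d[] to []c, d[]
    fixes [a], so it comes from the stabilizer of [proj a]. If this is trivial, []c, d[] is
    wandering; if it is cyclic, the lift is a power of one lift [F], and part of a fundamental
    domain of [F] or an interval fixed pointwise will do. *)
Let wandering_off_invariant (K : set R) c d : closed K -> K !=set0 ->
  (forall F x, lifts F -> K x -> K (F x)) ->
  c < d -> (forall x, c < x < d -> ~ K x) ->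
  exists c' d', [/\ c <= c', d' <= d & wandering lifts c' d'].
Proof.
move=> clK [k0 Kk0] K_inv cd Kcd.
have [Lid Lcomp Linv] := lifts_group.
pose A := [set y | K y /\ y <= c].
have A0 : A !=set0.
  pose m := Num.floor (k0 - c) + 1.
  exists (k0 + (- m)%:~R); split.
    exact: (K_inv _ _ (lifts_shift (- m)) Kk0).
  by have := floorD1_gt (k0 - c); rewrite intrN -/m; lra.
have ubA : has_ubound A by exists c => y [].
pose a := sup A.
have Ka : K a.
  apply: clK => B /(closure_sup A0 ubA)[y [[Ky _] By]]; by exists y.
have a_c : a <= c by apply: ge_sup => // y [].
have a_max y z : K y -> y < z -> z < d -> y <= a.
  move=> Ky yz zd; apply: ub_le_sup => //; split => //.
  rewrite leNgt; apply/negP => cy; apply: (Kcd y) => //.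
  by rewrite cy (lt_trans yz zd).
have fix_a F y : lifts F -> c < y < d -> c < F y < d -> F a = a.
  move=> LF /andP[cy yd] /andP[cFy Fyd].
  have [G [LG FG GF]] := Linv _ LF.
  (* [F a] and [G a] lie in [K], to the left of [F y] and [y], which are in []c, d[]; so both are at
     most [a]. *)
  apply/eqP; rewrite eq_le; apply/andP; split.
    apply: (a_max _ (F y)) => //; first exact: K_inv.
    by apply: lifts_lt LF _ _ _; exact: le_lt_trans cy.
  have Ga : G a <= a.
    apply: (a_max _ y) => //; first exact: K_inv.
    by rewrite -[y]FG; apply: lifts_lt LG _ _ _; exact: le_lt_trans cFy.
  by rewrite -[a in a <= _]GF; apply: (ltW_homo (lifts_lt LF)).
have stab g F : Gamma g -> increasing_lift g F -> F a = a ->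
    stabilizer Gamma (proj a) g.
  by move=> Gg [[_ Fg] _] Fa; split => //; rewrite Fg Fa.
case: (Gamma_stab (proj a)) => [triv|[_ [phi cyc]]].
  exists c, d; split => //; split => // F y LF yab Fyab z _.
  have Fa := fix_a _ _ LF yab Fyab; have [g Gg Fg] := LF.
  have gid : g = id by have := stab _ _ Gg Fg Fa; rewrite triv.
  rewrite gid in Fg.
  by rewrite (increasing_lift_agree (a := a) Fg increasing_lift_id).
have [Gphi phi_a] : stabilizer Gamma (proj a) phi.
  by rewrite cyc; exact: sub_gen_smallest.
have [F Fphi Fa] := fixing_lift Gphi phi_a.
have [_ _ /(_ _ Gphi)[psi [Gpsi phiK psiK]]] := Gamma_group.
have [G [Gpsi' FG GF]] := increasing_lift_inv phiK psiK Gpsi Fphi.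
have LF : lifts F by exists phi.
have LG : lifts G by exists psi.
have Ga : G a = a by rewrite -[in LHS]Fa FG.
have powers H y : lifts H -> c < y < d -> c < H y < d ->
    exists k, H =1 iter k F \/ H =1 iter k G.
  move=> LH yab Hyab; have Ha := fix_a _ _ LH yab Hyab; have [g Gg Hg] := LH.
  have := stab _ _ Gg Hg Ha; rewrite cyc.
  move=> /(cyclic_powers phiK psiK)[m [n gE]].
  have iter_lift f E k : increasing_lift f E ->
      increasing_lift (iter k f) (iter k E).
    move=> Ef; elim: k => [|k IH]; first exact: increasing_lift_id.
    exact: (increasing_lift_comp Ef IH).
  (* Both sides are increasing lifts of [g] that fix [a], so they coincide. *)
  have HE : H = iter m F \o iter n G.
    apply: (increasing_lift_agree (g := g) (a := a)) => //.
      by rewrite gE; apply: increasing_lift_comp; exact: iter_lift.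
    by rewrite /= !iter_fix.
  have FGn k t : iter k F (iter k G t) = t.
    by elim: k t => // k IH t; rewrite iterSr /= GF IH.
  have [nm|mn] := leqP n m.
    exists (m - n)%N; left => t.
    by rewrite HE /= -{1}(subnK nm) iterD FGn.
  exists (n - m)%N; right => t.
  by rewrite HE /= -{1}(subnKC (ltnW mn)) iterD FGn.
have [[x [xcd xFx]]|fixF] := pselect (exists x, c < x < d /\ F x <> x).
  have [xF|Fx|/esym xF] := ltgtP x (F x); last by case: xFx.
    exact: (wandering_of_powers LF GF xcd xF powers).
  (* When [F] moves [x] to the left, its inverse moves it to the right. *)
  apply: (wandering_of_powers LG FG xcd) => [|H y LH yab Hyab].
    by rewrite -[X in X < _]FG; exact: lifts_lt LG _ _ Fx.
  by have [k [|]] := powers _ _ LH yab Hyab; exists k; [right|left].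
have {}fixF x : c < x < d -> F x = x.
  by move=> xcd; apply: contrapT => nF; apply: fixF; exists x.
(* Here [F] is the identity on []c, d[]; the middle third keeps the closed interval in [wandering]
   inside []c, d[]. *)
exists ((2 * c + d) / 3), ((c + 2 * d) / 3); split; [lra|lra|split; first lra].
move=> H y LH yab Hyab z zab.
have inner t : (2 * c + d) / 3 <= t <= (c + 2 * d) / 3 -> c < t < d.
  by move=> /andP[? ?]; apply/andP; split; lra.
have inner' t : (2 * c + d) / 3 < t < (c + 2 * d) / 3 -> c < t < d.
  by move=> /andP[? ?]; apply/andP; split; lra.
have Fz := fixF _ (inner _ zab).
have Gz : G z = z by rewrite -[in LHS]Fz FG.
have [k Hk] := powers _ _ LH (inner' _ yab) (inner' _ Hyab).
by case: Hk => ->; rewrite iter_fix.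
Qed.

(** The closure [C] of the orbit of [t0] under the lifts is invariant and omits [v]. If []a, b[]
    meets the complement of [C], use [C]; otherwise use the closure of that complement, which is
    also invariant and contains [v]. *)
Lemma lifts_wandering_dense : ~ minimal_action Gamma -> forall a b, a < b ->
  exists c d, [/\ a <= c, d <= b & wandering lifts c d].
Proof.
move=> nonmin a b ab; have [Lid Lcomp Linv] := lifts_group.
have [p /denseNE[U [[q [openU Uq]] disj]]] :
    exists p, ~ dense (Defs.orbit Gamma p).
  apply: contrapT => h; apply: nonmin => p; apply: contrapT => np.
  by apply: h; exists p.
have [t0 t0p] := proj_surj p; have [v vq] := proj_surj q.
pose orb := [set t | exists2 F, lifts F & t = F t0].
pose C := closure orb.
have orbU t : orb t -> ~ U (proj t).
  move=> [F [g Gg [[_ Fg] _]] ->] Ut.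
  have : (U `&` Defs.orbit Gamma p) (proj (F t0)).
    by split => //; exists g => //; rewrite -t0p Fg.
  by rewrite disj.
have vC : ~ C v.
  have : nbhs q U by exact: open_nbhs_nbhs.
  move=> /nbhs_ballP[e /= e0 eU] /(_ (ball v e)) [|t [orbt]].
    exact: nbhsx_ballx.
  rewrite /ball/= => vt; apply: (orbU _ orbt); apply: eU.
  rewrite -vq ballEmdist/=; exact: le_lt_trans (cdist_le v t) vt.
have closure_inv (A : set R) F : lifts F -> (forall x, A x -> A (F x)) ->
    forall x, closure A x -> closure A (F x).
  move=> LF AF x clx B /(lifts_continuous LF)/clx[y [Ay By]].
  by exists (F y); split => //; exact: AF.
have orb_inv F x : lifts F -> orb x -> orb (F x).
  by move=> LF [H LH ->]; exists (F \o H) => //; exact: Lcomp.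
have C_inv F x : lifts F -> C x -> C (F x).
  by move=> LF; apply: closure_inv => // y; exact: orb_inv.
have [[x [/andP[ax xb] nCx]]|Cab] := pselect (exists x, a < x < b /\ ~ C x).
  have : nbhs x (~` C).
    apply: open_nbhs_nbhs; split => //; apply: closed_openC.
    exact: closed_closure.
  move=> /nbhs_ballP[e /= e0 eC].
  have [||||y|c [d [c1 d1 W]]] := @wandering_off_invariant C
    (Num.max a (x - e)) (Num.min b (x + e)).
  - exact: closed_closure.
  - by exists t0; apply: subset_closure; exists id.
  - exact: C_inv.
  - by rewrite lt_min !gt_max; apply/andP; split; apply/andP; split; lra.
  - rewrite gt_max lt_min => /andP[/andP[_ y1] /andP[_ y2]]; apply: eC.
    by rewrite /ball/= ltr_norml; apply/andP; split; lra.
  exists c, d; split => //.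
    by apply: le_trans c1; rewrite le_max lexx.
  by apply: le_trans d1 _; rewrite ge_min lexx.
(* Now the orbit is dense in ]a, b[, which thus avoids the closure of [~` C]. *)
have {}Cab x : a < x < b -> C x.
  by move=> xab; apply: contrapT => nC; apply: Cab; exists x.
apply: (@wandering_off_invariant (closure (~` C))) => //.
- exact: closed_closure.
- by exists v; exact: subset_closure.
- move=> F x LF; apply: closure_inv => // y nCy CFy; apply: nCy.
  by have [G [LG FG _]] := Linv _ LF; rewrite -[y]FG; exact: C_inv.
- move=> x xab /(_ `]a, b[%classic)[|y [nCy]].
    by apply: near_in_itvoo; rewrite in_itv.
  by rewrite /= in_itv/= => /Cab.
Qed.

End Lifts.

(** * Passing to the circle *)

Lemma descend_to_circle (R : realType) (f : R -> R) :
  (forall t (m : int), f (t + m%:~R) = f t + m%:~R) ->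
  exists h : circle R -> circle R, forall t, h (proj t) = proj (f t).
Proof.
move=> fD; have [r rP] := choice (@proj_surj R).
exists (fun p => proj (f (r p))) => t; apply/projP.
have /projP/intrP[m rt] := rP (proj t).
have -> : r (proj t) = t + m%:~R by rewrite -rt addrC subrK.
by rewrite fD addrC addKr intr_int.
Qed.

Lemma Lipschitz_descend (R : realType) (f : R -> R)
    (h : circle R -> circle R) (K : R) :
  0 < K -> (forall t, h (proj t) = proj (f t)) ->
  (forall x y, `|f x - f y| <= K * `|x - y|) ->
  forall p q, mdist (h p) (h q) <= K * mdist p q.
Proof.
move=> K0 hf fK p q; rewrite mulrC -ler_pdivrMr//.
apply/ler_addgt0Pr => e e0.
have [x [y [<- <- xy]]] := cdist_adherent p q e0.
rewrite ler_pdivrMr// !hf; apply: le_trans (cdist_le _ _) _.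
by apply: le_trans (fK x y) _; rewrite mulrC ler_wpM2r// ltW.
Qed.

Lemma Lipschitz_circle_continuous (R : realType)
    (h : circle R -> circle R) (K : R) : 0 < K ->
  (forall p q, mdist (h p) (h q) <= K * mdist p q) -> continuous h.
Proof.
move=> K0 hK p A /nbhs_ballP[e /= e0 eA].
apply/nbhs_ballP; exists (e / K); first by rewrite /= divr_gt0.
move=> q; rewrite ballEmdist/= ltr_pdivlMr// => pq; apply: eA.
by rewrite ballEmdist/=; apply: le_lt_trans (hK p q) _; rewrite mulrC.
Qed.

(** Near [t] the local representative [F] differs from [f] by an integer-valued function that is
    continuous at [t], hence constant near [t]; an integer translation then moves [t] to [x]. *)
Lemma differentiable_at_lift (R : realType) (f : R -> R)
    (h : circle R -> circle R) x :
  continuous f -> (forall t (m : int), f (t + m%:~R) = f t + m%:~R) ->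
  (forall t, h (proj t) = proj (f t)) ->
  differentiable_at h (proj x) -> derivable f x 1.
Proof.
move=> cf fD hf [t [F [tx hF dF]]].
have dft : derivable f t 1.
  apply: (@near_eq_derivable _ _ _ (fun s => F s + (f t - F t))); last first.
    by apply: derivableD => //; exact: derivable_cst.
  pose g s := f s - F s.
  have cg : {for t, continuous g}.
    apply: cvgB; first exact: cf.
    by apply/differentiable_continuous/derivable1_diffP.
  move/cvgrPdist_lt : cg => /(_ _ ltr01) near_g.
  near=> s; have /intrP[m gs] : g s \is a Num.int.
    by apply/projP; rewrite -hf; near: s.
  have /intrP[n gt] : g t \is a Num.int.
    by apply/projP; rewrite -hf; exact: nbhs_singleton hF.
  have : `|g t - g s| < 1 by near: s.
  rewrite gs gt -intrB -intr_norm -[1]/(1%:~R) ltr_int => mn.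
  have nm : n = m by lia.
  have : g t = g s by rewrite gs gt nm.
  by rewrite /g => ->; rewrite addrC subrK.
have /projP/intrP[m tm] := tx.
have -> : f = (fun s => s - m%:~R) \o f \o (fun s => s + m%:~R).
  by apply/funext => s /=; rewrite fD addrK.
have tE : t = x + m%:~R by rewrite -tm addrC subrK.
have shift_diff (y c : R) : differentiable (fun s : R => s + c) y.
  apply/derivable1_diffP; apply: derivableD; first exact: derivable_id.
  exact: derivable_cst.
apply/derivable1_diffP; apply: differentiable_comp; first exact: shift_diff.
apply: differentiable_comp; last exact: shift_diff.
by rewrite -tE; apply/derivable1_diffP.
Unshelve. all: by end_near. Qed.

Theorem theoremB (R : realType) (Gamma : set (circle R -> circle R))
  (Gamma_group : transformation_group Gamma)
  (Gamma_fg : finitely_generated Gamma)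
  (Gamma_diffeo : forall g, Gamma g -> Ck_diffeo 2 g /\ orientation_preserving g)
  (Gamma_nonminimal : ~ minimal_action Gamma)
  (Gamma_stab : forall x : circle R,
     stabilizer Gamma x = [set id] \/ infinite_cyclic (stabilizer Gamma x)) :
  exists h : circle R -> circle R,
    [/\ homeomorphism h /\ orientation_preserving h,
        bi_Lipschitz h,
        ~ Ck_map 1 h,
        forall g, Gamma g -> h \o g = g \o h
      & forall J : set (circle R), open_interval J ->
          ~ (forall p, J p -> differentiable_at h p)].
Proof.
pose L := lifts Gamma.
have L_group : transformation_group L := lifts_group Gamma_group Gamma_diffeo.
have L_shift : forall m : int, L (fun t => t + m%:~R) := lifts_shift Gamma_group.
have L_derivable F (t : R) : L F -> derivable F t 1.
  by move=> /(lifts_C2 Gamma_diffeo)[].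
have W_dense := lifts_wandering_dense Gamma_group Gamma_diffeo Gamma_stab
  Gamma_nonminimal.
have [S [M [SL SD M0 slS genS]]] :=
  lifts_generators Gamma_group Gamma_diffeo Gamma_fg.
have [G [G_slope G_corner]] := exists_dense_corners R.
have [D Dmax] := ex_maximal_disjoint_subcollection (saturation L)
  [set p | wandering L p.1 p.2].
pose C := expR (2 * M).
have C1 : 1 <= C by rewrite -[leLHS]expR0 ler_expR mulr_ge0.
have dist a b F : wandering L a b -> L F -> slope_ratio_le C a b F.
  exact: (wandering_distortion L_group (@lifts_lt _ _) L_shift SL SD M0 slS genS).
pose f := bent L G D; pose K := 3 * C.
have K0 : 0 < K by rewrite mulr_gt0// (lt_le_trans ltr01).
have fL F x : L F -> f (F x) = F (f x).
  exact: (bent_equivariant L_group (@lifts_lt _ _) G_slope Dmax).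
have fD t (m : int) : f (t + m%:~R) = f t + m%:~R.
  exact: (fL _ _ (L_shift m)).
have f_bilip x y : x < y -> y - x <= K * (f y - f x) /\ f y - f x <= K * (y - x).
  exact: (bent_bilipschitz L_group (@lifts_lt _ _) C1 dist G_slope Dmax).
have f_lt x y : x < y -> f x < f y.
  move=> xy; rewrite -subr_gt0 -(pmulr_rgt0 _ K0).
  by apply: lt_le_trans (proj1 (f_bilip _ _ xy)); rewrite subr_gt0.
(* The second bound makes the inverse [f'] Lipschitz with the same constant. *)
have f_lip x y : `|f x - f y| <= K * `|x - y| /\ `|x - y| <= K * `|f x - f y|.
  have [xy|yx|->] := ltgtP x y; last by rewrite !subrr !normr0 !mulr0.
    rewrite !(distrC x) !(distrC (f x)) !gtr0_norm ?subr_gt0 ?f_lt//.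
    by have [] := f_bilip _ _ xy.
  by rewrite !gtr0_norm ?subr_gt0 ?f_lt//; have [] := f_bilip _ _ yx.
have f_surj y : exists x, f x = y.
  exact: (bent_surjective L_group (@lifts_lt _ _) L_shift C1 dist G_slope Dmax).
have [f' f'K] := choice f_surj.
have fK x : f' (f x) = x.
  have [] := f_lip (f' (f x)) x; rewrite f'K subrr normr0 mulr0 => _.
  by rewrite normr_le0 subr_eq0 => /eqP.
have f'D t (m : int) : f' (t + m%:~R) = f' t + m%:~R.
  by rewrite -[in LHS](f'K t) -fD fK.
have [h hf] := descend_to_circle fD; have [k kf] := descend_to_circle f'D.
have hk : cancel h k.
  by move=> p; have [t <-] := proj_surj p; rewrite hf kf fK.
have kh : cancel k h.
  by move=> p; have [t <-] := proj_surj p; rewrite kf hf f'K.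
have h_lip : forall p q, mdist (h p) (h q) <= K * mdist p q.
  by apply: (Lipschitz_descend K0 hf) => x y; have [] := f_lip x y.
have k_lip : forall p q, mdist (k p) (k q) <= K * mdist p q.
  apply: (Lipschitz_descend K0 kf) => x y.
  by have [_] := f_lip (f' x) (f' y); rewrite !f'K.
have f_cont : continuous f.
  exact: (bent_continuous L_group (@lifts_lt _ _) C1 dist G_slope Dmax).
have h_nondiff J : open_interval J -> ~ (forall p, J p -> differentiable_at h p).
  move=> [a [b [ab _ ->]]] dh.
  have [x [xab]] := bent_not_derivable L_group (@lifts_lt _ _) W_dense L_derivable
    G_slope G_corner Dmax ab.
  apply; apply: (differentiable_at_lift f_cont fD hf); apply: dh.
  by exists x => //=; rewrite in_itv.
exists h; split => //.
- split.
    exists k; split => //; first exact: (Lipschitz_circle_continuous K0 h_lip).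
    exact: (Lipschitz_circle_continuous K0 k_lip).
  by exists f; split => //; split.
- by exists k; split => //; exists K.
- move=> [F [[_ hF] [dF _]]].
  (* A [C^1] lift would make [h] differentiable on a whole arc. *)
  have J01 : open_interval (@proj R @` `]0, 1[%classic).
    by exists 0, 1; rewrite add0r.
  apply: (h_nondiff _ J01).
  move=> _ [t _ <-]; exists t, F; split => //; last exact: (dF 0%N).
  by apply/nbhs_ballP; exists 1 => //= s _; exact: hF.
- move=> g Gg; have [_ [F [[cF Fg] incF]]] := Gamma_diffeo _ Gg.
  have LF : L F by exists g.
  apply/funext => p /=; have [t <-] := proj_surj p.
  by rewrite Fg !hf fL// Fg.
Qed.
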